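(* Suppose every component $f_i:\mathbb{R}^d\to\mathbb{R}$ ($i=1,\dots,n$, $n\ge 2$) is differentiable with $L$-Lipschitz gradient, the average $F=\frac1n\sum_{i=1}^n f_i$ is $\mu$-strongly convex with $0<\mu\le L$ and unique minimizer $x_\star$, and, for some $\nu\in(0,1]$ and $\rho_\nu\ge0$, $F$ is twice differentiable with $\|\nabla^2F(u)-\nabla^2F(v)\|_{\mathrm{op}}\le\rho_\nu\|u-v\|^\nu$ for all $u,v\in\mathbb{R}^d$. Let $K\ge1$, $T=nK\ge3$, run random reshuffling with constant component stepsize $\eta=\frac{4\log T}{\mu T}$, and suppose $K\ge128\frac{L^2}{\mu^2}\log T$. Then $$ \mathbb{E}\|y_K-x_\star\|^2\le\frac{D^2}{T^2}+\frac{1024L^2G^2\log^2T}{\mu^4T^2}+\frac{384L^2G^2n^2\log^3T}{\mu^4T^3}+\frac{2^{7+2\nu}}{(1+\nu)^2}\,\frac{\rho_\nu^2G^{2+2\nu}n^{1+\nu}\log^{2+2\nu}T}{\mu^{4+2\nu}T^{2+2\nu}}. $$ In particular, $$ \mathbb{E}[F(y_K)-F(x_\star)]=\widetilde{\mathcal O}\left(T^{-2}+n^2T^{-3}+n^{1+\nu}T^{-2-2\nu}\right). $$ If $\nu\ge\frac12$, then $n^{1+\nu}T^{-2-2\nu}\le n^2T^{-3}$, and hence $$ \mathbb{E}[F(y_K)-F(x_\star)]=\widetilde{\mathcal O}\left(T^{-2}+n^2T^{-3}\right). $$ This last $(n,K)$-dependence is minimax-sharp up to logarithms in the constant-stepsize,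 last-epoch-iterate model: the problem class contains all smooth strongly convex quadratic instances, and for suitable fixed problem parameters (independent of $n,K$) the worst case over such instances of $\mathbb{E}[F(y_K)-F(x_\star)]$ is $\Omega\left(\frac1{(nK)^2}+\frac1{nK^3}\right)$ for random reshuffling with any constant stepsize.
   Context: Random reshuffling (RR) with constant component stepsize $\eta>0$ starts from a deterministic point $y_0\in\mathbb{R}^d$. At each epoch $k=0,1,\dots,K-1$ it draws a fresh, independent, uniformly random permutation $\pi_k$ of $\{1,\dots,n\}$, sets $x_{k,0}=y_k$, performs $x_{k,i}=x_{k,i-1}-\eta\nabla f_{\pi_k(i)}(x_{k,i-1})$ for $i=1,\dots,n$, and sets $y_{k+1}=x_{k,n}$. Expectations are over the permutations. Constants: $G_\star:=\max_{i}\|\nabla f_i(x_\star)\|$, $D:=\max\{\|y_0-x_\star\|,\,G_\star/(2L)\}$, $G:=G_\star+2LD$. The notation $\widetilde{\mathcal O}(\phi)$ means a bound $C(\log T)^p\phi$ with $p$ an absolute constant and $C$ depending only on the fixed problem parameters $L,\mu,\rho_\nu,\nu,G,D$ (not on $n,K$); $\Omega(\phi)$ means at least $c\,\phi$ with $c>0$ depending only on fixed problem parameters. The quadratic lower bound $\Omega((nK)^{-2}+1/(nK^3))$ for constant-stepsize RR is a known result of Safran and Shamir (2020). *)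

(* Defs.v *)
From HB Require Import structures.
From mathcomp Require Import all_boot all_order all_algebra all_fingroup.
From mathcomp Require Import all_classical all_reals all_analysis.

Set Implicit Arguments.
Unset Strict Implicit.
Unset Printing Implicit Defensive.

Import Order.TTheory GRing.Theory Num.Theory.
Import numFieldNormedType.Exports.

Local Open Scope classical_set_scope.
Local Open Scope ring_scope.

(* The norm `|x| that MathComp-Analysis puts on 'rV[R]_d is the sup norm. It
   induces the usual topology and hence the usual notion of differentiability,
   but every quantitative statement below uses this Euclidean norm. *)
Definition l2norm (R : realType) (d : nat) (x : 'rV[R]_d) : R :=
  Num.sqrt (\sum_(j < d) x ord0 j ^+ 2).

Definition opnorm (R : realType) (d : nat) (A : 'M[R]_d) : R :=
  sup [set l2norm (v *m A) | v in [set v : 'rV[R]_d | l2norm v <= 1]].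

(* Meaningful at the points where f is differentiable; 'D_v is the directional
   derivative. *)
Definition grad (R : realType) (d : nat) (f : 'rV[R]_d -> R)
    (x : 'rV[R]_d) : 'rV[R]_d :=
  \row_(j < d) 'D_(delta_mx ord0 j) f x.

Definition hessian (R : realType) (d : nat) (f : 'rV[R]_d -> R)
    (x : 'rV[R]_d) : 'M[R]_d :=
  'J (grad f) x.

Definition average (R : realType) (d n : nat) (f : 'I_n -> 'rV[R]_d -> R)
    (x : 'rV[R]_d) : R :=
  n%:R^-1 * \sum_(i < n) f i x.

Definition lipschitz_grad (R : realType) (L : R) (d : nat)
    (f : 'rV[R]_d -> R) : Prop :=
  (forall x, differentiable f x) /\
  (forall x y, l2norm (grad f x - grad f y) <= L * l2norm (x - y)).

Definition strongly_convex (R : realType) (mu : R) (d : nat)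
    (F : 'rV[R]_d -> R) : Prop :=
  forall (x y : 'rV[R]_d) (t : R), 0 <= t <= 1 ->
    F (t *: x + (1 - t) *: y) <=
      t * F x + (1 - t) * F y - mu / 2 * t * (1 - t) * l2norm (x - y) ^+ 2.

Definition unique_minimizer (R : realType) (d : nat) (F : 'rV[R]_d -> R)
    (xs : 'rV[R]_d) : Prop :=
  (forall x, F xs <= F x) /\
  (forall z, (forall x, F z <= F x) -> z = xs).

Definition holder_hessian (R : realType) (rho nu : R) (d : nat)
    (F : 'rV[R]_d -> R) : Prop :=
  [/\ forall x, differentiable F x,
      forall x, differentiable (grad F) x &
      forall u v, opnorm (hessian F u - hessian F v)
                    <= rho * l2norm (u - v) `^ nu].

Definition admissible_params (R : realType) (L mu rho nu : R) : Prop :=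
  [/\ 0 < mu <= L, 0 < nu <= 1 & 0 <= rho].

Definition problem_class (R : realType) (L mu rho nu : R) (d n : nat)
    (f : 'I_n -> 'rV[R]_d -> R) (xs : 'rV[R]_d) : Prop :=
  [/\ forall i, lipschitz_grad L (f i),
      strongly_convex mu (average f),
      unique_minimizer (average f) xs &
      holder_hessian rho nu (average f)].

Definition is_quadratic (R : realType) (d : nat) (f : 'rV[R]_d -> R) : Prop :=
  exists (A : 'M[R]_d) (b : 'rV[R]_d) (c : R), forall x : 'rV[R]_d,
    f x = 2^-1 * (x *m A *m x^T) ord0 ord0 + (x *m b^T) ord0 ord0 + c.

Definition Gstar (R : realType) (d n : nat) (f : 'I_n -> 'rV[R]_d -> R)
    (xs : 'rV[R]_d) : R :=
  \big[Num.max/0]_(i < n) l2norm (grad (f i) xs).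

Definition Dconst (R : realType) (L : R) (d n : nat)
    (f : 'I_n -> 'rV[R]_d -> R) (xs y0 : 'rV[R]_d) : R :=
  Num.max (l2norm (y0 - xs)) (Gstar f xs / (2 * L)).

Definition Gconst (R : realType) (L : R) (d n : nat)
    (f : 'I_n -> 'rV[R]_d -> R) (xs y0 : 'rV[R]_d) : R :=
  Gstar f xs + 2 * L * Dconst L f xs y0.

(* enum 'I_n lists 0, ..., n-1 in increasing order, so the inner steps (and,
   in rr_iterate, the epochs) are performed in their natural order. *)
Definition rr_epoch (R : realType) (d n : nat) (f : 'I_n -> 'rV[R]_d -> R)
    (eta : R) (s : 'S_n) (y : 'rV[R]_d) : 'rV[R]_d :=
  foldl (fun x i => x - eta *: grad (f (s i)) x) y (enum 'I_n).

Definition rr_iterate (R : realType) (d n K : nat)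
    (f : 'I_n -> 'rV[R]_d -> R) (eta : R) (y0 : 'rV[R]_d)
    (s : {ffun 'I_K -> 'S_n}) : 'rV[R]_d :=
  foldl (fun y k => rr_epoch f eta (s k) y) y0 (enum 'I_K).

(* The law of K independent uniformly random permutations is the uniform law
   on the finite set of K-tuples of permutations. *)
Definition rr_expect (R : realType) (n K : nat)
    (X : {ffun 'I_K -> 'S_n} -> R) : R :=
  #|{: {ffun 'I_K -> 'S_n}}|%:R^-1 * \sum_s X s.

Definition rr_sqdist (R : realType) (d n K : nat)
    (f : 'I_n -> 'rV[R]_d -> R) (eta : R) (xs y0 : 'rV[R]_d) : R :=
  rr_expect (fun s : {ffun 'I_K -> 'S_n} =>
    l2norm (rr_iterate f eta y0 s - xs) ^+ 2).

Definition rr_gap (R : realType) (d n K : nat)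
    (f : 'I_n -> 'rV[R]_d -> R) (eta : R) (xs y0 : 'rV[R]_d) : R :=
  rr_expect (fun s : {ffun 'I_K -> 'S_n} =>
    average f (rr_iterate f eta y0 s) - average f xs).

Definition rr_regime (R : realType) (L mu : R) (n K : nat) : Prop :=
  [/\ (2 <= n)%N, (1 <= K)%N, (3 <= n * K)%N &
      128 * (L ^+ 2 / mu ^+ 2) * ln ((n * K)%:R : R) <= K%:R].

Definition rr_stepsize (R : realType) (mu : R) (n K : nat) : R :=
  4 * ln (n * K)%:R / (mu * (n * K)%:R).

(* E[F(y_K) - F(x_star)] = O~(phi(n, K)), uniformly over the instances with
   parameters satisfying P: the exponent p is absolute, and the factor C
   depends only on the parameters (not on d, n, K or the instance). *)
Definition rr_gap_tildeO (R : realType) (P : R -> Prop)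
    (phi : R -> nat -> nat -> R) : Prop :=
  exists p : nat, forall L mu rho nu G D : R,
    admissible_params L mu rho nu -> P nu ->
  exists2 C : R, 0 < C &
    forall (d n K : nat) (f : 'I_n -> 'rV[R]_d -> R) (xs y0 : 'rV[R]_d),
      problem_class L mu rho nu f xs ->
      rr_regime L mu n K ->
      Dconst L f xs y0 = D -> Gconst L f xs y0 = G ->
      rr_gap K f (rr_stepsize mu n K) xs y0
        <= C * ln (n * K)%:R ^+ p * phi nu n K.

(* Main.v *)
(** Upper bound. With [gam = eta * n], an epoch started at [y] ends at
    [y - gam * grad F y] plus an error due to evaluating the gradients at the
    moving iterates [x_i] instead of [y]. The mean step contracts towards the
    minimizer. The expected error is small for two reasons. Exchanging position
    [i] of the permutation with a uniformly random position shows that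
    [grad f_(pi i) (x_i)] may be replaced by [grad F (x_i)], since the exchange
    moves [x_i] by [O(eta G)] only. And [grad F (x_i) - grad F y] is, up to a
    Lipschitz and a Hölder remainder, linear in the centered fluctuation
    [- eta * sum_(m < i) (grad f_(pi m) y - grad F y)], whose variance
    [O(eta^2 G^2 n)] is that of sampling without replacement.

    Lower bound. The hard instance is separable on [R^3]. Coordinate 0 starts at
    1 and defeats stepsizes that are too large (divergence) or too small (no
    progress). In coordinate 1 curvature and linear part are correlated across
    the components, which biases the mean iterate by order [eta]. Coordinate 2
    has constant curvature, and its variance is of order [eta^3 n^2]. *)
Require Import Defs.
From HB Require Import structures.
From mathcomp Require Import all_boot all_order all_algebra all_fingroup.
From mathcomp Require Import all_classical all_reals all_analysis.
From mathcomp Require Import ring lra zify.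

Set Implicit Arguments.
Unset Strict Implicit.
Unset Printing Implicit Defensive.

Import Order.TTheory GRing.Theory Num.Theory.
Import numFieldNormedType.Exports.

Local Open Scope classical_set_scope.
Local Open Scope ring_scope.

(** * Averages over finite sets and over permutations *)

(** Bounded gradients are derived, not assumed. The condition on [K] says [gam * L ^+ 2 <= mu / 32].
    An exact gradient step then contracts by order [gam * mu], while the error of an epoch is at
    most [gam * mu / 8 * D]. So the radius [D] is preserved for every permutation, and [G] bounds
    all gradients met in all epochs. The mean squared distance contracts by [1 - gam * mu / 2] per
    epoch. The stepsize makes [K * gam * mu / 2] equal to [2 log T], hence the [T^-2] in front of
    the initial distance; the geometric series multiplies the error of an epoch by [2 / (gam * mu)].
    In the lower bound a single instance must fail for every stepsize. Between [32 n K eta <= 1] and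
    [eta >= 1/4], both settled by coordinate 0, the cases are split at [n eta = 4]. Above, the noise
    of the last epoch alone costs order [1/n]. Below, all damping products exceed [exp(-16)], so
    bias and variance stay comparable to their first-order values. *)

Definition avg (R : realType) (T : finType) (X : T -> R) : R :=
  #|T|%:R^-1 * \sum_t X t.

Section Average.
Variables (R : realType) (T : finType).
Implicit Types X Y : T -> R.

Lemma avgD X Y : avg (fun t => X t + Y t) = avg X + avg Y.
Proof. by rewrite /avg big_split mulrDr. Qed.

Lemma avgZ c X : avg (fun t => c * X t) = c * avg X.
Proof. by rewrite /avg -mulr_sumr mulrCA. Qed.

Lemma avgN X : avg (fun t => - X t) = - avg X.
Proof. by rewrite /avg sumrN mulrN. Qed.

Lemma avgB X Y : avg (fun t => X t - Y t) = avg X - avg Y.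
Proof. by rewrite avgD avgN. Qed.

Lemma eq_avg X Y : X =1 Y -> avg X = avg Y.
Proof. by move=> e; rewrite /avg; congr (_ * _); apply: eq_bigr. Qed.

Lemma avg_sum (I : finType) (P : pred I) (X : I -> T -> R) :
  avg (fun t => \sum_(i | P i) X i t) = \sum_(i | P i) avg (X i).
Proof. by rewrite /avg exchange_big -mulr_sumr. Qed.

Lemma le_avg X Y : (forall t, X t <= Y t) -> avg X <= avg Y.
Proof.
by move=> le; apply: ler_wpM2l; [rewrite invr_ge0 | apply: ler_sum => t _].
Qed.

Lemma avg_ge0 X : (forall t, 0 <= X t) -> 0 <= avg X.
Proof. by move=> X0; rewrite mulr_ge0 ?invr_ge0 ?sumr_ge0. Qed.

Lemma avg_reindex (h : T -> T) X :
  bijective h -> avg (fun t => X (h t)) = avg X.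
Proof.
by move=> bh; rewrite /avg [in RHS](reindex h) //; apply: onW_bij.
Qed.

Hypothesis T0 : (0 < #|T|)%N.

Lemma avg_cst (c : R) : avg (fun _ : T => c) = c.
Proof.
by rewrite /avg sumr_const -[X in _ * X]mulr_natl mulKf // pnatr_eq0 -lt0n.
Qed.

Lemma avg_le_cst X (c : R) : (forall t, X t <= c) -> avg X <= c.
Proof. by move=> le; rewrite -(avg_cst c); apply: le_avg. Qed.

Lemma sqr_avg_le X : avg X ^+ 2 <= avg (fun t => X t ^+ 2).
Proof.
have : 0 <= avg (fun t => (X t - avg X) ^+ 2).
  by apply: avg_ge0 => t; rewrite sqr_ge0.
rewrite (@eq_avg _ (fun t => X t ^+ 2 + (- (2 * avg X) * X t + avg X ^+ 2))).
  rewrite !avgD avgZ avg_cst; lra.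
by move=> t /=; ring.
Qed.

End Average.

Section PermutationAverage.
Variables (R : realType) (n : nat).
Implicit Types s : 'S_n.

Lemma card_Sn_gt0 : (0 < #|'S_n|)%N.
Proof. by apply/card_gt0P; exists 1%g. Qed.

Lemma avg_permM (t : 'S_n) (X : 'S_n -> R) :
  avg (fun s => X (s * t)%g) = avg X.
Proof.
apply: (avg_reindex (h := fun s => (s * t)%g)).
by exists (mulg^~ t^-1)%g => s; rewrite ?mulgK ?mulgKV.
Qed.

Lemma avg_Mperm (t : 'S_n) (X : 'S_n -> R) :
  avg (fun s => X (t * s)%g) = avg X.
Proof.
apply: (avg_reindex (h := fun s => (t * s)%g)).
by exists (mulg t^-1)%g => s; rewrite ?mulKg ?mulKVg.
Qed.

(** Composing with a transposition shows that the average does not depend on the position; summed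
    over all positions, the quantity is the same for every permutation. *)
Lemma avg_perm1 (phi : 'I_n -> R) (i : 'I_n) :
  avg (fun s => phi (s i)) = n%:R^-1 * \sum_a phi a.
Proof.
have n0 : n%:R != 0 :> R by rewrite pnatr_eq0 -lt0n (leq_trans _ (ltn_ord i)).
apply: (mulfI n0); rewrite mulVKf //.
transitivity (\sum_(j < n) avg (fun s => phi (s j))).
  rewrite mulr_natl -[X in _ *+ X]card_ord -sumr_const; apply: eq_bigr => j _.
  by rewrite -(avg_Mperm (tperm i j)); apply: eq_avg => s; rewrite permM tpermL.
rewrite -avg_sum -[RHS](avg_cst card_Sn_gt0); apply: eq_avg => s.
by rewrite [RHS](reindex_inj (@perm_inj _ s)).
Qed.

Lemma avg_perm2 (phi : 'I_n -> 'I_n -> R) (i j : 'I_n) : i != j ->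
  avg (fun s => phi (s i) (s j)) =
  (n%:R * (n%:R - 1))^-1 * \sum_a \sum_(b | b != a) phi a b.
Proof.
move=> ij.
have n1 : (1 < n)%N.
  case: n i j ij => [[]//|[|m]] //= i j; by rewrite (ord1 i) (ord1 j) eqxx.
have nn0 : n%:R * (n%:R - 1) != 0 :> R.
  by rewrite mulf_neq0 // ?subr_eq0 ?(eqr_nat _ _ 1) ?pnatr_eq0; case: n n1 => [|[]].
apply: (mulfI nn0); rewrite mulVKf //.
have E a b : b != a ->
    avg (fun s => phi (s a) (s b)) = avg (fun s => phi (s i) (s j)).
  (* The first transposition sends [i] to [a] and [j] to [c]; the second fixes [a] and sends [c] to
     [b]. *)
  move=> ba; pose c := tperm i a j; have ac : a != c.
    by rewrite -{1}(tpermL i a) (inj_eq perm_inj).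
  rewrite -[RHS](avg_Mperm (tperm i a * tperm c b)); apply: eq_avg => s.
  by rewrite !permM tpermL -/c tpermL tpermD // eq_sym.
transitivity (\sum_(a < n) \sum_(b | b != a) avg (fun s => phi (s a) (s b))).
  under [RHS]eq_bigr => a _.
    rewrite (eq_bigr _ (E a)) sumr_const (cardC1 a) card_ord; over.
  rewrite sumr_const card_ord -mulrnA -[RHS]mulr_natl natrM.
  by rewrite -subn1 natrB 1?ltnW // [X in X * _ = _]mulrC.
under eq_bigr do rewrite -avg_sum.
rewrite -avg_sum -[RHS](avg_cst card_Sn_gt0); apply: eq_avg => s.
rewrite [RHS](reindex_inj (@perm_inj _ s)); apply: eq_bigr => a _.
rewrite [RHS](reindex_inj (@perm_inj _ s)) /=; apply: eq_bigl => b.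
by rewrite (inj_eq perm_inj).
Qed.

(** The variance of sampling without replacement: for centered [z] the off-diagonal products sum to
    minus the diagonal ones. General weights serve twice, as indicators of a prefix in the upper
    bound and as powers of [1 - eta] in the lower bound. *)
Lemma avg_sqr_perm_sum (a z : 'I_n -> R) : (2 <= n)%N -> \sum_i z i = 0 ->
  avg (fun s => (\sum_i a i * z (s i)) ^+ 2) =
  (\sum_i z i ^+ 2) / (n%:R * (n%:R - 1)) *
  (n%:R * \sum_i a i ^+ 2 - (\sum_i a i) ^+ 2).
Proof.
move=> n2 z0.
have n0 : n%:R != 0 :> R by rewrite pnatr_eq0; case: n n2.
have n10 : n%:R - 1 != 0 :> R by rewrite subr_eq0 (eqr_nat _ _ 1); case: n n2 => [|[]].
have off (b : 'I_n -> R) : \sum_i \sum_(j | j != i) b i * b j =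
    (\sum_i b i) ^+ 2 - \sum_i b i ^+ 2.
  rewrite expr2 big_distrl /= -sumrB; apply: eq_bigr => i _.
  by rewrite -!mulr_sumr [X in _ = _ * X - _](bigD1 i) //=; ring.
have sq s : (\sum_i a i * z (s i)) ^+ 2 =
   \sum_i (a i ^+ 2 * (z (s i) ^+ 2)) +
   \sum_i \sum_(j | j != i) a i * a j * (z (s i) * z (s j)).
  rewrite -[LHS](subrK (\sum_i (a i * z (s i)) ^+ 2)) -off addrC; congr (_ + _).
    by apply: eq_bigr => i _; rewrite exprMn.
  by apply: eq_bigr => i _; apply: eq_bigr => j _; ring.
rewrite (eq_avg sq) avgD !avg_sum.
under eq_bigr => i _ do rewrite avgZ (avg_perm1 (fun a => z a ^+ 2)).
under [X in _ + X]eq_bigr => i _.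
  rewrite avg_sum; under eq_bigr => j ji.
    rewrite avgZ (avg_perm2 (fun x y => z x * z y)); last by rewrite eq_sym.
    rewrite off z0 expr0n /= sub0r; over.
  rewrite -mulr_suml; over.
rewrite -!mulr_suml off; field.
by rewrite n0 n10.
Qed.

End PermutationAverage.

(** * Euclidean norm and operator norm *)

Section EuclideanNorm.
Variables (R : realType) (d : nat).
Implicit Types (x y z w : 'rV[R]_d) (a : R).

Definition dotv x y : R := \sum_(j < d) x ord0 j * y ord0 j.

Lemma dotvC x y : dotv x y = dotv y x.
Proof. by apply: eq_bigr => j _; rewrite mulrC. Qed.

Lemma dotvDl x y z : dotv (x + y) z = dotv x z + dotv y z.
Proof. by rewrite -big_split; apply: eq_bigr => j _; rewrite mxE mulrDl. Qed.

Lemma dotvZl a x y : dotv (a *: x) y = a * dotv x y.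
Proof. by rewrite [RHS]mulr_sumr; apply: eq_bigr => j _; rewrite mxE mulrA. Qed.

Lemma dotvNl x y : dotv (- x) y = - dotv x y.
Proof. by rewrite -scaleN1r dotvZl mulN1r. Qed.

Lemma dotvDr x y z : dotv x (y + z) = dotv x y + dotv x z.
Proof. by rewrite dotvC dotvDl !(dotvC x). Qed.

Lemma dotvZr a x y : dotv x (a *: y) = a * dotv x y.
Proof. by rewrite dotvC dotvZl dotvC. Qed.

Lemma dotvNr x y : dotv x (- y) = - dotv x y.
Proof. by rewrite dotvC dotvNl dotvC. Qed.

Lemma dotvBr x y z : dotv x (y - z) = dotv x y - dotv x z.
Proof. by rewrite dotvDr dotvNr. Qed.

Lemma dotv0l x : dotv 0 x = 0.
Proof. by rewrite -(scale0r 0) dotvZl mul0r. Qed.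

Lemma dotv0r x : dotv x 0 = 0.
Proof. by rewrite dotvC dotv0l. Qed.

Lemma dotv_sumr (I : finType) (P : pred I) w (x : I -> 'rV[R]_d) :
  dotv w (\sum_(i | P i) x i) = \sum_(i | P i) dotv w (x i).
Proof.
rewrite /dotv exchange_big; apply: eq_bigr => j _.
by rewrite summxE mulr_sumr.
Qed.

Lemma dotv_mulmxr w x (A : 'M[R]_d) : dotv w (x *m A) = dotv (w *m A^T) x.
Proof.
rewrite /dotv.
under eq_bigr do rewrite mxE mulr_sumr.
under [RHS]eq_bigr do rewrite mxE mulr_suml.
rewrite exchange_big; apply: eq_bigr => j _; apply: eq_bigr => i _.
by rewrite !mxE; ring.
Qed.

Lemma l2norm_ge0 x : 0 <= l2norm x.
Proof. exact: sqrtr_ge0. Qed.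

Lemma sqr_l2norm x : l2norm x ^+ 2 = dotv x x.
Proof.
rewrite sqr_sqrtr; last by apply: sumr_ge0 => j _; exact: sqr_ge0.
by apply: eq_bigr => j _; rewrite expr2.
Qed.

Lemma sqr_l2normD x y :
  l2norm (x + y) ^+ 2 = l2norm x ^+ 2 + 2 * dotv x y + l2norm y ^+ 2.
Proof. by rewrite !sqr_l2norm !dotvDl !dotvDr (dotvC y x); ring. Qed.

Lemma l2normZ a x : l2norm (a *: x) = `|a| * l2norm x.
Proof.
rewrite -sqrtr_sqr -sqrtrM ?sqr_ge0 // mulr_sumr; congr Num.sqrt.
by apply: eq_bigr => j _; rewrite mxE exprMn.
Qed.

Lemma l2norm0 : l2norm (0 : 'rV[R]_d) = 0.
Proof. by rewrite -(scale0r 0) l2normZ normr0 mul0r. Qed.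

Lemma l2normN x : l2norm (- x) = l2norm x.
Proof. by rewrite -scaleN1r l2normZ normrN1 mul1r. Qed.

Lemma l2normC x y : l2norm (x - y) = l2norm (y - x).
Proof. by rewrite -l2normN opprB. Qed.

Lemma l2norm_eq0 x : l2norm x = 0 -> x = 0.
Proof.
move=> /(congr1 (fun r => r ^+ 2)); rewrite sqr_l2norm expr0n /= => /eqP.
rewrite psumr_eq0 => [/allP x0|j _]; last by rewrite -expr2 sqr_ge0.
apply/rowP => j; rewrite mxE; apply/eqP.
by have := x0 j; rewrite mem_index_enum mulf_eq0 orbb => /(_ isT).
Qed.

Lemma coord_le_l2norm x j : `|x ord0 j| <= l2norm x.
Proof.
rewrite -sqrtr_sqr ler_sqrt; last by apply: sumr_ge0 => k _; exact: sqr_ge0.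
by rewrite (bigD1 j) //= lerDl; apply: sumr_ge0 => k _; exact: sqr_ge0.
Qed.

(** Lagrange's identity: summed over ordered index pairs, the squared 2x2 minors of [x], [y] give
    twice the gap in the squared inequality. *)
Lemma dotv_le x y : dotv x y <= l2norm x * l2norm y.
Proof.
apply: le_trans (ler_norm _) _.
rewrite -(@ler_pXn2r _ 2) ?nnegrE ?normr_ge0 ?mulr_ge0 ?l2norm_ge0 //.
rewrite exprMn !sqr_l2norm real_normK ?num_real //.
have := @sumr_ge0 R _ (index_enum 'I_d) predT (fun i => \sum_(j < d)
  (x ord0 i * y ord0 j - x ord0 j * y ord0 i) ^+ 2).
have -> : \sum_i \sum_(j < d) (x ord0 i * y ord0 j - x ord0 j * y ord0 i) ^+ 2 =
    2 * (dotv x x * dotv y y - dotv x y ^+ 2).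
  have row (i : 'I_d) : \sum_(j < d) (x ord0 i * y ord0 j - x ord0 j * y ord0 i) ^+ 2 =
      x ord0 i * x ord0 i * dotv y y + dotv x x * (y ord0 i * y ord0 i) -
      2 * dotv x y * (x ord0 i * y ord0 i).
    rewrite /dotv !mulr_sumr !mulr_suml -sumrN -!big_split /=.
    by apply: eq_bigr => j _; ring.
  under eq_bigr do rewrite row.
  rewrite !big_split /= sumrN -mulr_sumr -mulr_suml -mulr_sumr.
  by rewrite -!/(dotv _ _); ring.
move=> H; suff : 0 <= 2 * (dotv x x * dotv y y - dotv x y ^+ 2) by lra.
by apply: H => i _; apply: sumr_ge0 => j _; exact: sqr_ge0.
Qed.

Lemma l2normD x y : l2norm (x + y) <= l2norm x + l2norm y.
Proof.
rewrite -(@ler_pXn2r _ 2) ?nnegrE ?addr_ge0 ?l2norm_ge0 //.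
by rewrite sqr_l2normD; have := dotv_le x y; lra.
Qed.

Lemma l2normB x y : l2norm (x - y) <= l2norm x + l2norm y.
Proof. by rewrite -(l2normN y) l2normD. Qed.

Lemma l2norm_triangle z x y : l2norm (x - y) <= l2norm (x - z) + l2norm (z - y).
Proof. by rewrite (le_trans _ (l2normD _ _)) // subrKA. Qed.

Lemma l2norm_sum (I : finType) (P : pred I) (x : I -> 'rV[R]_d) :
  l2norm (\sum_(i | P i) x i) <= \sum_(i | P i) l2norm (x i).
Proof.
apply: (big_ind2 (fun u v => l2norm u <= v)) => //; first by rewrite l2norm0.
by move=> u a v b ua vb; rewrite (le_trans (l2normD _ _)) ?lerD.
Qed.

Lemma l2norm_mulmx_le_opnorm x (A : 'M[R]_d) :
  l2norm (x *m A) <= opnorm A * l2norm x.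
Proof.
(* [sup] takes a default value on unbounded sets, so the image of the unit ball is first bounded by
   the sum of the row norms. *)
have bnd : has_ubound [set l2norm (v *m A) | v in [set v : 'rV[R]_d | l2norm v <= 1]].
  exists (\sum_(i < d) l2norm (row i A)) => _ [v /= v1 <-].
  rewrite mulmx_sum_row (le_trans (l2norm_sum _ _)) //.
  apply: ler_sum => i _; rewrite l2normZ ler_piMl ?l2norm_ge0 //.
  exact: le_trans (coord_le_l2norm _ _) v1.
have [/l2norm_eq0 ->|x0] := eqVneq (l2norm x) 0.
  by rewrite mul0mx l2norm0 mulr0.
have xp : 0 < l2norm x by rewrite lt_def x0 l2norm_ge0.
rewrite -ler_pdivrMr //; apply: ub_le_sup => //.
exists ((l2norm x)^-1 *: x) => /=.
  by rewrite l2normZ ger0_norm ?invr_ge0 ?l2norm_ge0 // mulVf.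
by rewrite -scalemxAl l2normZ ger0_norm ?invr_ge0 ?l2norm_ge0 // mulrC.
Qed.

Lemma opnorm0 : opnorm (0 : 'M[R]_d) = 0.
Proof.
rewrite /opnorm (_ : [set _ | _ in _] = [set 0]) ?sup1 //.
apply/seteqP; split=> [_ [v /= _ <-]|_ ->] /=; first by rewrite mulmx0 l2norm0.
by exists 0; rewrite ?mulmx0 /= l2norm0.
Qed.

End EuclideanNorm.

(** * Gradients, strong convexity and Taylor expansion *)

Section Calculus.
Variables (R : realType) (d : nat).
Implicit Types (f F : 'rV[R]_d -> R) (x y u v w : 'rV[R]_d).

Lemma derive_dotv_grad f x v : differentiable f x -> 'D_v f x = dotv v (grad f x).
Proof.
move=> df; rewrite deriveE // [in LHS](row_sum_delta v) linear_sum.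
by apply: eq_bigr => j _; rewrite linearZ mxE deriveE.
Qed.

Lemma is_derive_line (W : normedModType R) (g : 'rV[R]_d -> W) x v (t : R) :
  derivable g (x + t *: v) v ->
  is_derive t 1 (fun s : R => g (x + s *: v)) ('D_v g (x + t *: v)).
Proof.
have E : (fun h : R => h^-1 *: (g (x + (h *: 1 + t) *: v) - g (x + t *: v))) =
         (fun h : R => h^-1 *: (g (h *: v + (x + t *: v)) - g (x + t *: v))).
  apply/funext => h; congr (_ *: (g _ - _)).
  by rewrite scalerDl addrCA [h *: 1]mulr1.
by move=> dg; split; rewrite /derivable /derive /= E.
Qed.

(** The derivative exists, so quotients from the right determine it; [C * h] leaves room for a
    second-order remainder. *)
Lemma derive_le_of_right f x v (l C : R) : derivable f x v -> 0 <= C ->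
  (forall h, 0 < h <= 1 -> f (x + h *: v) - f x <= h * (l + C * h)) ->
  'D_v f x <= l.
Proof.
move=> df C0 H; apply/ler_addgt0Pr => e e0.
have /cvg_dnbhs_at_right D : (fun h : R => h^-1 *: (f (h *: v + x) - f x)) @ 0^' --> 'D_v f x.
  exact: df.
apply: (cvgr_to_le D); near=> h.
have h0 : 0 < h by near: h; exact: nbhs_right_gt.
have h1 : h <= 1 by near: h; exact: nbhs_right_le.
have he : h <= e / (C + 1) by near: h; apply: nbhs_right_le; rewrite divr_gt0 ?ltr_wpDl.
rewrite [_ *: _]mulrC ler_pdivrMr // addrC mulrC [h *: v + x]addrC.
rewrite addrC (le_trans (H _ _)) ?h0 //; apply: ler_wpM2l; first exact: ltW.
rewrite lerD2l; move: he; rewrite ler_pdivlMr ?ltr_wpDl // => he.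
by nra.
Unshelve. all: by end_near. Qed.

Lemma grad_minimizer F x : differentiable F x -> (forall y, F x <= F y) ->
  grad F x = 0.
Proof.
move=> dF mF.
have D0 v : 0 <= dotv v (grad F x).
  have : 'D_v (- F) x <= 0.
    apply: (@derive_le_of_right _ _ _ _ 0) => //.
      by apply: derivableN; exact: diff_derivable.
    move=> h _; rewrite mul0r addr0 mulr0 /= opprK addrC subr_le0; exact: mF.
  rewrite deriveN; last exact: diff_derivable.
  by rewrite oppr_le0 derive_dotv_grad.
apply: l2norm_eq0; apply/eqP; rewrite -sqrf_eq0 eq_le sqr_ge0 andbT.
by have := D0 (- grad F x); rewrite dotvNl oppr_ge0 sqr_l2norm.
Qed.

Lemma strongly_convex_grad (mu : R) F x y : 0 <= mu -> strongly_convex mu F ->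
  differentiable F x ->
  dotv (y - x) (grad F x) <= F y - F x - mu / 2 * l2norm (y - x) ^+ 2.
Proof.
move=> mu0 sc dF; rewrite -derive_dotv_grad //.
(* The remainder comes from the factor [t * (1 - t)] of strong convexity, which is [h - h ^+ 2] at
   [t = h]. *)
apply: (@derive_le_of_right _ _ _ _ (mu / 2 * l2norm (y - x) ^+ 2)).
- exact: diff_derivable.
- by rewrite mulr_ge0 ?sqr_ge0 // divr_ge0.
move=> h /andP[h0 h1]; have := sc y x h; rewrite h1 ltW //= => /(_ isT).
have -> : h *: y + (1 - h) *: x = x + h *: (y - x).
  by rewrite scalerBl scale1r scalerBr addrCA addrA -addrA addrC.
by lra.
Qed.

Lemma grad_average n (f : 'I_n -> 'rV[R]_d -> R) x :
  (forall i, differentiable (f i) x) ->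
  grad (average f) x = n%:R^-1 *: \sum_i grad (f i) x.
Proof.
move=> df; apply/rowP => j; rewrite !mxE summxE.
have -> : average f = n%:R^-1 *: \sum_i f i.
  by apply/funext => z; rewrite /average /= fct_sumE.
rewrite deriveZ; last by apply: derivable_sum => i; exact: diff_derivable.
rewrite derive_sum; last by move=> i; exact: diff_derivable.
by congr (_ *: _); apply: eq_bigr => i _; rewrite mxE.
Qed.

Lemma differentiable_average n (f : 'I_n -> 'rV[R]_d -> R) x :
  (forall i, differentiable (f i) x) -> differentiable (average f) x.
Proof.
move=> df; have -> : average f = n%:R^-1 *: \sum_i f i.
  by apply/funext => z; rewrite /average /= fct_sumE.
by apply: differentiableZ; apply: differentiable_sum.
Qed.

Lemma is_derive_dotv w (M : R -> 'rV[R]_d) (t : R) (D : 'rV[R]_d) :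
  is_derive t 1 M D -> is_derive t 1 (fun s => dotv w (M s)) (dotv w D).
Proof.
move=> dM; have dMj j : is_derive t 1 (fun s => M s ord0 j) (D ord0 j).
  have dM' : derivable M t 1 by exact: ex_derive.
  split; first exact: (derivable_mxP M t 1).1.
  by have := derive_mx dM'; rewrite derive_val => ->; rewrite mxE.
have -> : (fun s => dotv w (M s)) = \sum_j (w ord0 j *: (fun s => M s ord0 j)).
  by apply/funext => s; rewrite fct_sumE; apply: eq_bigr.
by apply: is_derive_eq.
Qed.

(** Instead of integrating the Hessian along the segment, [C * t^(1 + nu)] is subtracted from the
    remainder at time [t]: its derivative [C * (1 + nu) * t^nu] is exactly the Hölder bound, so the
    difference [psi] is nonincreasing. *)
Lemma holder_hessian_taylor (rho nu : R) F y u w : 0 < nu ->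
  holder_hessian rho nu F ->
  dotv w (grad F (y + u) - grad F y - u *m hessian F y) <=
  l2norm w * (rho / (1 + nu) * l2norm u `^ (1 + nu)).
Proof.
move=> nu0 [_ dgF hF].
pose C := l2norm w * (rho / (1 + nu) * l2norm u `^ (1 + nu)).
pose k := dotv w (u *m hessian F y).
pose phi (t : R) := dotv w (grad F (y + t *: u)) - t * k.
have dphi (t : R) : is_derive t 1 phi (dotv w (u *m hessian F (y + t *: u)) - k).
  have dg : is_derive t 1 (fun s => grad F (y + s *: u)) (u *m hessian F (y + t *: u)).
    have := is_derive_line (diff_derivable (v := u) (dgF (y + t *: u))).
    by rewrite (deriveEjacobian u (dgF _)).
  have dk : is_derive t 1 (fun s : R => s * k) k.
    have := is_deriveM (is_derive_id t 1) (is_derive_cst k t 1).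
    by rewrite scaler0 add0r [_ *: _]mulr1.
  exact: (is_deriveB (is_derive_dotv w dg) dk).
pose psi (t : R) := phi t - C * t `^ (1 + nu).
have dpsi (t : R) : 0 < t -> is_derive t 1 psi
    (dotv w (u *m hessian F (y + t *: u)) - k - C * ((1 + nu) * t `^ nu)).
  move=> t0; have dp := is_deriveZ C (is_derive1_powR (1 + nu) t0).
  rewrite addrAC subrr add0r in dp.
  exact: (is_deriveB (dphi t) dp).
have psi_cont (t : R) : 0 < t -> {for t, continuous psi}.
  move=> t0; apply/differentiable_continuous/derivable1_diffP.
  by have [] := dpsi t t0.
suff : psi 1 <= psi 0.
  rewrite /psi /phi powR1 powR0 ?gt_eqF ?addr_gt0 // scale1r scale0r addr0.
  by rewrite !dotvBr -/k -/C; lra.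
have drv (t : R) : t \in `]0, 1[ -> derivable psi t 1.
  by rewrite in_itv /= => /andP[t0 _]; have [] := dpsi t t0.
have drv_le (t : R) : t \in `]0, 1[ -> psi^`()%classic t <= 0.
  rewrite in_itv /= => /andP[t0 _].
  rewrite derive1E; have [_ ->] := dpsi t t0.
  have hess : l2norm (u *m (hessian F (y + t *: u) - hessian F y)) <=
      rho * (t `^ nu * l2norm u `^ (1 + nu)).
    rewrite (le_trans (l2norm_mulmx_le_opnorm _ _)) //.
    have -> : l2norm u `^ (1 + nu) = l2norm u * l2norm u `^ nu.
      by rewrite -(@mulr_powRB1 _ _ (1 + nu)) ?l2norm_ge0 ?addr_gt0 // addrAC subrr add0r.
    rewrite [t `^ nu * _]mulrCA [leRHS]mulrCA [leRHS]mulrC.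
    rewrite ler_wpM2r ?l2norm_ge0 //.
    apply: le_trans (hF _ _) _; have -> : y + t *: u - y = t *: u.
      by rewrite addrAC subrr add0r.
    by rewrite l2normZ gtr0_norm // powRM ?l2norm_ge0 // ltW.
  have CE : C * ((1 + nu) * t `^ nu) =
      l2norm w * (rho * (t `^ nu * l2norm u `^ (1 + nu))).
    by rewrite /C; field; rewrite gt_eqF // addr_gt0.
  rewrite subr_le0 CE -dotvBr -mulmxBr.
  exact: le_trans (dotv_le _ _) (ler_wpM2l (l2norm_ge0 w) hess).
(* The derivative of [psi] was computed for positive [t] only, so continuity at 0 is checked
   separately for [phi] and for the power. *)
have cont : {within `[0, 1], continuous psi}.
  apply/continuous_within_itvP => //; split.
  - by move=> t; rewrite in_itv /= => /andP[t0 _]; exact: psi_cont.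
  - rewrite /psi powR0 ?gt_eqF ?addr_gt0 //; apply: cvgB.
      apply: cvg_at_right_filter; apply/differentiable_continuous/derivable1_diffP.
      by have [] := dphi 0.
    by apply: cvgMr; apply: powR_cvg0; rewrite addr_gt0.
  - by apply: cvg_at_left_filter; exact: psi_cont.
by apply: (ler0_derive1_le_cc drv drv_le cont); rewrite ?in_itv /= ?lexx ?ler01.
Qed.

End Calculus.

(** * Trajectories of one epoch *)

Section Trajectory.
Variables (R : realType) (d n : nat) (g : 'I_n -> 'rV[R]_d -> 'rV[R]_d) (eta : R).
Implicit Types (s : 'S_n) (y : 'rV[R]_d).

(** Cutting the epoch after [m] steps gives access to the intermediate iterates, which are compared
    between permutations. *)
Definition traj s y (m : nat) : 'rV[R]_d :=
  foldl (fun x i => x - eta *: g (s i) x) y (take m (enum 'I_n)).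

Lemma traj0 s y : traj s y 0 = y.
Proof. by rewrite /traj take0. Qed.

Lemma trajS s y (i : 'I_n) :
  traj s y i.+1 = traj s y i - eta *: g (s i) (traj s y i).
Proof.
rewrite /traj (take_nth i) ?size_enum_ord ?ltn_ord // foldl_rcons.
by rewrite nth_ord_enum.
Qed.

Lemma big_ord_ltS (V : nmodType) (F : 'I_n -> V) (i : 'I_n) :
  \sum_(j < n | (j < i.+1)%N) F j = F i + \sum_(j < n | (j < i)%N) F j.
Proof.
rewrite (bigD1 i) //=; congr (_ + _); apply: eq_bigl => j.
by rewrite ltnS [in RHS]ltn_neqAle andbC.
Qed.

Lemma big_ord_lt0 (V : nmodType) (F : 'I_n -> V) :
  \sum_(j < n | (j < 0)%N) F j = 0.
Proof. by rewrite big_pred0. Qed.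

Lemma big_ord_ltn (V : nmodType) (F : 'I_n -> V) :
  \sum_(j < n | (j < n)%N) F j = \sum_j F j.
Proof. by apply: eq_bigl => j; rewrite ltn_ord. Qed.

Lemma trajE s y m : (m <= n)%N ->
  traj s y m = y - eta *: \sum_(i < n | (i < m)%N) g (s i) (traj s y i).
Proof.
elim: m => [|m IH] mn; first by rewrite traj0 big_ord_lt0 scaler0 subr0.
rewrite (trajS s y (Ordinal mn)) (big_ord_ltS _ (Ordinal mn)) /=.
by rewrite scalerDr opprD addrCA -IH ?(ltnW mn) // addrC.
Qed.

Lemma eq_traj s s' y m : (m <= n)%N ->
  (forall i : 'I_n, (i < m)%N -> s i = s' i) -> traj s y m = traj s' y m.
Proof.
elim: m => [|m IH] mn ss'; first by rewrite !traj0.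
rewrite (trajS s y (Ordinal mn)) (trajS s' y (Ordinal mn)) ss' //=.
by rewrite IH // ?(ltnW mn) // => i im; apply: ss'; exact: ltnW.
Qed.

End Trajectory.

Lemma rr_epochE (R : realType) (d n : nat) (f : 'I_n -> 'rV[R]_d -> R) eta s y :
  rr_epoch f eta s y = traj (fun i => grad (f i)) eta s y n.
Proof. by rewrite /traj take_oversize ?size_enum_ord. Qed.

(** * Elementary inequalities: growth factors, sums of squares, powers *)

Lemma exp1D_le (R : realType) (x c : R) (k n : nat) :
  0 <= x -> (k <= n)%N -> n%:R * x <= c -> c < 1 -> (1 + x) ^+ k <= (1 - c)^-1.
Proof.
move=> x0 kn nx c1.
have k1 : k%:R * x <= c.
  by apply: le_trans nx; rewrite ler_wpM2r // ler_nat.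
rewrite -[leRHS]mul1r ler_pdivlMr ?subr_gt0 //.
(* The induction works because [(1 + x) * (1 - (k + 1) x) <= 1 - k x]. *)
have H : (1 + x) ^+ k * (1 - k%:R * x) <= 1.
  elim: k {kn k1} => [|k IH]; first by rewrite expr0 mul0r subr0 mulr1.
  apply: le_trans IH; rewrite exprS -mulrA mulrCA ler_wpM2l ?exprn_ge0 ?addr_ge0 //.
  by rewrite -[k.+1]addn1 natrD; have := ler0n R k; nra.
by apply: le_trans H; rewrite ler_wpM2l ?exprn_ge0 ?addr_ge0 //; lra.
Qed.

Lemma sum_ord_le (R : realType) (n : nat) (F : 'I_n -> R) (c : R) :
  (forall i, F i <= c) -> \sum_i F i <= n%:R * c.
Proof.
move=> Fc; apply: (@le_trans _ _ (\sum_(i < n) c)); first exact: ler_sum.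
by rewrite sumr_const card_ord mulr_natl.
Qed.

Lemma sqr_sum_le (R : realType) (n : nat) (x : 'I_n -> R) :
  (\sum_i x i) ^+ 2 <= n%:R * \sum_i x i ^+ 2.
Proof.
case: n x => [|n] x; first by rewrite !big_ord0 mulr0 expr0n.
have := @sqr_avg_le R 'I_n.+1 _ x; rewrite /avg card_ord => /(_ isT).
have n0 : 0 < n.+1%:R :> R by rewrite ltr0n.
rewrite exprMn -(ler_pM2l (exprn_gt0 2 n0)) mulrA -exprMn divff ?gt_eqF //.
by rewrite expr1n mul1r [n.+1%:R ^+ 2]expr2 -mulrA mulVKf ?gt_eqF.
Qed.

(** The tangent of t -> t^(p/2) at [B ^+ 2], evaluated at [x ^+ 2]. For [z = x / B] it is Young's
    inequality for [z^p] and 1 with exponent [2 / p]; at [p = 2] the conjugate exponent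
    degenerates. *)
Lemma powR_sqr_le (R : realType) (x B p : R) : 0 <= x -> 0 < B -> 0 < p <= 2 ->
  x `^ p <= B `^ p + p / 2 * B `^ p * (x ^+ 2 / B ^+ 2 - 1).
Proof.
move=> x0 B0 /andP[p0 p2].
have Bp : 0 < B `^ p by rewrite powR_gt0.
rewrite -[x in x `^ p](divfK (lt0r_neq0 B0)) powRM ?divr_ge0 ?(ltW B0) //.
rewrite -expr_div_n; set z := x / B; have z0 : 0 <= z by rewrite divr_ge0 // ltW.
suff : z `^ p <= 1 + p / 2 * (z ^+ 2 - 1).
  by rewrite -(ler_pM2r Bp); lra.
move: p2; rewrite le_eqVlt => /predU1P[->|p2].
  by rewrite powR_mulrn // divff // mul1r addrC subrK.
have q0 : 0 < 1 - p / 2 by lra.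
have := @conjugate_powR R (z `^ p) 1 (2 / p) (1 - p / 2)^-1 (powR_ge0 _ _) ler01.
rewrite invr_gt0 q0 divr_gt0 // invf_div invrK => /(_ isT isT).
rewrite addrC subrK => /(_ erefl); rewrite mulr1 powR1 mul1r -powRrM.
by rewrite [p * (2 / p)]mulrC divfK ?gt_eqF // powR_mulrn //; lra.
Qed.

(* Jensen's inequality for the concave map t |-> t^(p/2), applied to X^2. *)
Lemma avg_powR_le (R : realType) (T : finType) (X : T -> R) (B p : R) :
  (0 < #|T|)%N -> (forall t, 0 <= X t) -> 0 <= B -> 0 < p <= 2 ->
  avg (fun t => X t ^+ 2) <= B ^+ 2 -> avg (fun t => X t `^ p) <= B `^ p.
Proof.
move=> T0 X0 B0 pp XB; have [p0 _] := andP pp.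
move: B0; rewrite le_eqVlt => /predU1P[B0|B0].
  have X20 t : X t = 0.
    have card0 : 0 < #|T|%:R^-1 :> R by rewrite invr_gt0 ltr0n.
    have : \sum_t X t ^+ 2 == 0.
      rewrite eq_le [X in _ && X]sumr_ge0 ?andbT => [|i _]; last exact: sqr_ge0.
      by rewrite -(pmulr_rle0 _ card0) (le_trans XB) // -B0 expr0n.
    rewrite psumr_eq0 => [|i _]; last exact: sqr_ge0.
    by move=> /allP /(_ t (mem_index_enum _)); rewrite sqrf_eq0 => /eqP.
  rewrite (@eq_avg _ _ _ (fun=> 0)) ?avg_cst ?powR_ge0 // => t.
  by rewrite X20 powR0 ?gt_eqF.
apply: (le_trans (le_avg (fun t => powR_sqr_le (X0 t) B0 pp))).
under eq_avg => t do rewrite [X in _ * (X - 1)]mulrC.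
rewrite avgD avgZ avgB avgZ !avg_cst // gerDl pmulr_rle0; last first.
  by rewrite mulr_gt0 ?powR_gt0 // divr_gt0.
by rewrite subr_le0 ler_pdivrMl ?exprn_gt0 // mulr1.
Qed.

(** * Expected progress of one epoch *)

Section Epoch.
Variables (R : realType) (d n : nat) (g : 'I_n -> 'rV[R]_d -> 'rV[R]_d).
Variables (gF : 'rV[R]_d -> 'rV[R]_d) (H : 'rV[R]_d -> 'M[R]_d).
Variables (L mu rho nu eta gam Gs D G : R) (xs : 'rV[R]_d).
Hypotheses (n2 : (2 <= n)%N) (mu_gt0 : 0 < mu) (muL : mu <= L).
Hypotheses (nu0 : 0 < nu) (nu1 : nu <= 1) (rho0 : 0 <= rho).
Hypotheses (eta0 : 0 < eta) (gamE : gam = eta * n%:R) (gamL2 : gam * L ^+ 2 <= mu / 32).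
Hypothesis gF_avg : forall x, gF x = n%:R^-1 *: \sum_i g i x.
Hypothesis g_lip : forall i x y, l2norm (g i x - g i y) <= L * l2norm (x - y).
Hypothesis gs_le : forall i, l2norm (g i xs) <= Gs.
Hypotheses (GsD : Gs <= 2 * L * D) (G_def : G = Gs + 2 * L * D).
Hypothesis gF_xs : gF xs = 0.
Hypothesis gF_mono : forall x, mu * l2norm (x - xs) ^+ 2 <= dotv (x - xs) (gF x).
Hypothesis gF_taylor : forall y u w, dotv w (gF (y + u) - gF y - u *m H y) <=
  l2norm w * (rho / (1 + nu) * l2norm u `^ (1 + nu)).

Let L_gt0 : 0 < L. Proof. exact: lt_le_trans muL. Qed.
Let nR_gt0 : 0 < n%:R :> R. Proof. by rewrite ltr0n; case: n n2. Qed.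
Let gam_gt0 : 0 < gam. Proof. by rewrite gamE mulr_gt0. Qed.

Let gamL : gam * L <= 1 / 32.
Proof.
rewrite -(ler_pM2r L_gt0) -mulrA -expr2 (le_trans gamL2) //; move: muL; lra.
Qed.

Let gammu : gam * mu <= 1 / 32.
Proof. by apply: le_trans gamL; rewrite ler_wpM2l // ltW. Qed.

Let gam2L2 : (gam * L) ^+ 2 <= gam * mu / 32.
Proof. rewrite exprMn [gam ^+ 2]expr2 -!mulrA ler_wpM2l ?(ltW gam_gt0) //. Qed.

Lemma gF_lip x y : l2norm (gF x - gF y) <= L * l2norm (x - y).
Proof.
rewrite !gF_avg -scalerBr -sumrB l2normZ gtr0_norm ?invr_gt0 //.
rewrite ler_pdivrMl // (le_trans (l2norm_sum _ _)) //.
by apply: sum_ord_le => i; exact: g_lip.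
Qed.

Lemma sum_g x : \sum_i g i x = n%:R *: gF x.
Proof. by rewrite gF_avg scalerA divff ?scale1r // gt_eqF. Qed.

Lemma sum_g_perm (s : 'S_n) x : \sum_i g (s i) x = n%:R *: gF x.
Proof. by rewrite -sum_g [RHS](reindex_inj (@perm_inj _ s)). Qed.

Lemma gd_contract y : l2norm (y - gam *: gF y - xs) ^+ 2 <=
  (1 - 2 * gam * mu + (gam * L) ^+ 2) * l2norm (y - xs) ^+ 2.
Proof.
have -> : y - gam *: gF y - xs = (y - xs) + - gam *: gF y.
  by rewrite scaleNr addrAC.
rewrite sqr_l2normD dotvZr l2normZ normrN gtr0_norm //.
have le1 : l2norm (gF y) ^+ 2 <= L ^+ 2 * l2norm (y - xs) ^+ 2.
  rewrite -exprMn ler_pXn2r ?nnegrE ?mulr_ge0 ?l2norm_ge0 ?(ltW L_gt0) //.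
  by have := gF_lip y xs; rewrite gF_xs subr0.
have /(ler_wpM2l (ltW gam_gt0)) le2 := gF_mono y.
have /(ler_wpM2l (sqr_ge0 gam)) := le1.
rewrite exprMn; nra.
Qed.

(** * One epoch from a fixed starting point *)

Section FixedStart.
Variables (y : 'rV[R]_d).
Hypothesis yD : l2norm (y - xs) <= D.
Notation r := (l2norm (y - xs)).
Notation x_ s m := (traj g eta s y m).

Let D_ge0 : 0 <= D. Proof. exact: le_trans (l2norm_ge0 _) yD. Qed.
Let G_le : G <= 4 * L * D. Proof. rewrite G_def; move: GsD; lra. Qed.
Let Gs_ge0 : 0 <= Gs.
Proof. exact: le_trans (l2norm_ge0 _) (gs_le (Ordinal (ltnW n2))). Qed.
Let G_ge0 : 0 <= G. Proof. by rewrite G_def addr_ge0 // !mulr_ge0 // ltW. Qed.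

(** The origin of [G]: within an epoch the iterates may leave the ball of radius [D], but not that
    of radius [2 * D]. *)
Lemma g_bound i x : l2norm (x - xs) <= 2 * D -> l2norm (g i x) <= G.
Proof.
move=> xD; rewrite -[g i x](subrK (g i xs)) (le_trans (l2normD _ _)) //.
rewrite G_def addrC lerD // (le_trans (g_lip _ _ _)) //.
by have := ler_wpM2l (ltW L_gt0) xD; lra.
Qed.

(** The two bounds feed each other: inside radius [2 * D] a step has length at most [eta * G], so
    the displacement is at most [gam * G <= 4 * gam * L * D <= D / 8]. The bound [G <= 4 * L * D] is
    the reason for the second entry in the maximum defining [D]. *)
Lemma traj_near s m : (m <= n)%N ->
  l2norm (x_ s m - y) <= eta * m%:R * G /\ l2norm (x_ s m - xs) <= 2 * D.
Proof.
elim: m => [|m IH] mn; first by rewrite traj0 subrr l2norm0 mulr0 mul0r; split=> //; move: yD D_ge0; lra.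
have [IH1 IH2] := IH (ltnW mn).
have le1 : l2norm (x_ s m.+1 - y) <= eta * m.+1%:R * G.
  rewrite (trajS _ _ s y (Ordinal mn)) /= addrAC.
  rewrite (le_trans (l2normB _ _)) // l2normZ gtr0_norm // -natr1.
  have := ler_wpM2l (ltW eta0) (g_bound (s (Ordinal mn)) IH2); move: IH1; lra.
split=> //; apply: le_trans (l2norm_triangle y _ _) _.
have : eta * m.+1%:R * G <= gam * (4 * L * D).
  rewrite gamE; apply: ler_pM => //; first by rewrite mulr_ge0 // ltW.
  by rewrite ler_wpM2l ?(ltW eta0) // ler_nat.
have := ler_wpM2r D_ge0 gamL; move: yD le1 D_ge0; lra.
Qed.

Lemma g_traj_bound i (s : 'S_n) m : (m <= n)%N -> l2norm (g i (x_ s m)) <= G.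
Proof. by move=> mn; apply: g_bound; have [] := traj_near s mn. Qed.

Definition drift s : R := \sum_(i < n) l2norm (x_ s i - y).

Lemma drift_ge0 s : 0 <= drift s.
Proof. by apply: sumr_ge0 => i _; exact: l2norm_ge0. Qed.

Definition epoch_err (s : 'S_n) : 'rV[R]_d :=
  - eta *: \sum_i (g (s i) (x_ s i) - g (s i) y).

Lemma traj_err s : x_ s n - xs = (y - gam *: gF y - xs) + epoch_err s.
Proof.
rewrite trajE // big_ord_ltn /epoch_err sumrB sum_g_perm scalerBr !scaleNr.
by rewrite scalerA -gamE opprK [- _ + _]addrC [RHS]addrAC subrKA.
Qed.

Lemma partial_err_le (s : 'S_n) m : l2norm (eta *: \sum_(i < n | (i < m)%N)
  (g (s i) (x_ s i) - g (s i) y)) <= eta * L * drift s.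
Proof.
rewrite l2normZ gtr0_norm // -mulrA ler_wpM2l ?(ltW eta0) //.
rewrite (le_trans (l2norm_sum _ _)) // mulr_sumr.
rewrite [leRHS](bigID (fun i : 'I_n => (i < m)%N)) /= ler_wpDr //.
  by apply: sumr_ge0 => i _; rewrite mulr_ge0 ?l2norm_ge0 ?(ltW L_gt0).
by apply: ler_sum => i _; exact: g_lip.
Qed.

Lemma epoch_err_le s : l2norm (epoch_err s) <= eta * L * drift s.
Proof.
by rewrite /epoch_err scaleNr l2normN; have := partial_err_le s n; rewrite big_ord_ltn.
Qed.

(** For squares the contraction is [1 - 63/32 * (gam * mu)], by [(gam * L) ^+ 2 <= gam * mu / 32];
    the square root halves the gain. *)
Lemma gd_contract1 : l2norm (y - gam *: gF y - xs) <= (1 - 63 / 64 * (gam * mu)) * r.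
Proof.
have c0 : 0 <= 1 - 63 / 64 * (gam * mu) by move: gammu; lra.
rewrite -(@ler_pXn2r _ 2) ?nnegrE ?mulr_ge0 ?l2norm_ge0 //.
rewrite (le_trans (gd_contract y)) // [leRHS]exprMn ler_wpM2r ?sqr_ge0 //.
by have := sqr_ge0 (63 / 64 * (gam * mu)); move: gam2L2; lra.
Qed.

(** The error [gam ^+ 2 * L * G] is at most [4 * (gam * L) ^+ 2 * D <= gam * mu / 8 * D], less than
    the gain of the gradient step. *)
Lemma epoch_invariant s : l2norm (x_ s n - xs) <= D.
Proof.
rewrite traj_err (le_trans (l2normD _ _)) //.
have drift_le : drift s <= n%:R * (gam * G).
  apply: sum_ord_le => i; have [h _] := traj_near s (ltnW (ltn_ord i)); apply: le_trans h _.
  by rewrite gamE ler_wpM2r // ler_wpM2l ?(ltW eta0) // ler_nat ltnW.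
have err : l2norm (epoch_err s) <= gam * mu / 8 * D.
  apply: le_trans (epoch_err_le s) _.
  have /(ler_wpM2l (mulr_ge0 (ltW eta0) (ltW L_gt0))) := drift_le.
  have -> : eta * L * (n%:R * (gam * G)) = gam ^+ 2 * L * G by rewrite gamE; ring.
  have /(ler_wpM2l (mulr_ge0 (sqr_ge0 gam) (ltW L_gt0))) := G_le.
  by have := ler_wpM2r D_ge0 gam2L2; lra.
have c0 : 0 <= 1 - 63 / 64 * (gam * mu) by move: gammu; lra.
have := ler_wpM2l c0 yD; have := gd_contract1.
have : 0 <= gam * mu * D by rewrite !mulr_ge0 // ltW.
by move: err; lra.
Qed.


Definition fluct (s : 'S_n) m : 'rV[R]_d :=
  - eta *: \sum_(i < n | (i < m)%N) (g (s i) y - gF y).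

(** Two effects are left besides the fluctuation: gradients taken at moved points, which cost the
    drift, and the mean displacement along [gF y], controlled by [r] since [gF xs = 0]. *)
Lemma traj_fluct_le (s : 'S_n) m : (m <= n)%N ->
  l2norm (x_ s m - y - fluct s m) <= eta * L * drift s + gam * L * r.
Proof.
move=> mn.
have -> : x_ s m - y - fluct s m =
    - (eta *: \sum_(i < n | (i < m)%N) (g (s i) (x_ s i) - g (s i) y) +
       eta *: \sum_(i < n | (i < m)%N) gF y).
  rewrite trajE // /fluct scaleNr opprK [y - _ - y]addrAC subrr add0r addrC.
  rewrite -scalerBr -scalerDr -scalerN -sumrB -big_split /= -sumrN.
  by congr (_ *: _); apply: eq_bigr => i _; rewrite opprD opprB addrAC.
rewrite l2normN (le_trans (l2normD _ _)) // lerD ?partial_err_le //.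
rewrite l2normZ gtr0_norm // gamE -!mulrA ler_wpM2l ?(ltW eta0) //.
rewrite (le_trans (l2norm_sum _ _)) //.
rewrite big_mkcond /=; apply: sum_ord_le => i; case: ifP => _; last by rewrite mulr_ge0 ?l2norm_ge0 ?(ltW L_gt0).
by have := gF_lip y xs; rewrite gF_xs subr0.
Qed.

(** Summed over the steps, the drift reappears on the right with coefficient [gam * L <= 1 / 32];
    absorbing it gives the factor [32 / 31]. *)
Lemma drift_le_fluct s :
  drift s <= 32 / 31 * (\sum_(i < n) l2norm (fluct s i) + n%:R * (gam * L * r)).
Proof.
have : drift s <= \sum_(i < n) l2norm (fluct s i) +
    n%:R * (eta * L * drift s + gam * L * r).
  rewrite -[n in n%:R]card_ord mulr_natl -sumr_const -big_split /=.
  apply: ler_sum => i _; rewrite -[x_ s i - y](subrK (fluct s i)).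
  rewrite (le_trans (l2normD _ _)) // addrC lerD // traj_fluct_le //.
  exact: ltnW.
have := ler_wpM2r (drift_ge0 s) gamL; rewrite gamE; lra.
Qed.

Lemma sum_ord_lt m : (m <= n)%N -> \sum_(i < n | (i < m)%N) (1 : R) = m%:R.
Proof.
elim: m => [|m IH] mn; first by rewrite big_ord_lt0.
by rewrite (big_ord_ltS _ (Ordinal mn)) IH ?(ltnW mn) // -natr1 addrC.
Qed.

Variable B : R.
Hypotheses (B_ge0 : 0 <= B) (B2 : B ^+ 2 = eta ^+ 2 * G ^+ 2 * n%:R / 2).

(** Every position is centered on average. This removes the term that is linear in the Hessian. *)
Lemma avg_dotv_fluct w m : avg (fun s => dotv w (fluct s m)) = 0.
Proof.
transitivity (- eta * \sum_(i < n | (i < m)%N) avg (fun s : 'S_n => dotv w (g (s i) y - gF y))).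
  by rewrite -avg_sum -avgZ; apply: eq_avg => s; rewrite dotvZr dotv_sumr.
rewrite big1 ?mulr0 // => i _.
rewrite (avg_perm1 (fun a => dotv w (g a y - gF y))) -dotv_sumr.
by rewrite sumrB sum_g sumr_const card_ord -[gF y *+ n]scaler_nat subrr dotv0r mulr0.
Qed.

(** Sampling without replacement in each coordinate, with the indicator of the first [m] positions
    as weights. This gives [eta ^+ 2 * G ^+ 2] times [m (n - m) / (n - 1)], and the last factor is
    at most [n / 2]. *)
Lemma avg_sqr_fluct m : (m <= n)%N -> avg (fun s => l2norm (fluct s m) ^+ 2) <= B ^+ 2.
Proof.
move=> mn.
pose z j a : R := (g a y - gF y) ord0 j.
have z0 j : \sum_a z j a = 0.
  have : (\sum_a (g a y - gF y)) ord0 j = 0.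
    by rewrite sumrB sum_g sumr_const card_ord -[gF y *+ n]scaler_nat subrr mxE.
  by rewrite summxE.
have E (s : 'S_n) : l2norm (fluct s m) ^+ 2 = \sum_(j < d)
    eta ^+ 2 * (\sum_(i < n) ((i < m)%N%:R : R) * z j (s i)) ^+ 2.
  rewrite sqr_l2norm; apply: eq_bigr => j _.
  rewrite mxE summxE -expr2 exprMn sqrrN; congr (_ * _ ^+ 2).
  by rewrite big_mkcond; apply: eq_bigr => i _; case: ifP; rewrite ?mul1r ?mul0r.
have sum1 : \sum_(i < n) ((i < m)%N%:R : R) = m%:R.
  by rewrite -sum_ord_lt // [RHS]big_mkcond; apply: eq_bigr => i _; case: ifP.
have sum2 : \sum_(i < n) ((i < m)%N%:R : R) ^+ 2 = m%:R.
  by rewrite -[RHS]sum1; apply: eq_bigr => i _; case: (_ < _)%N; rewrite ?expr1n ?expr0n.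
have zsum : \sum_(j < d) \sum_a z j a ^+ 2 <= n%:R * G ^+ 2.
  rewrite exchange_big /=.
  have -> : \sum_a \sum_(j < d) z j a ^+ 2 = \sum_a l2norm (g a y) ^+ 2 - n%:R * l2norm (gF y) ^+ 2.
    have zE a : \sum_(j < d) z j a ^+ 2 =
        l2norm (g a y) ^+ 2 + (l2norm (gF y) ^+ 2 - 2 * dotv (gF y) (g a y)).
      transitivity (l2norm (g a y - gF y) ^+ 2).
        by rewrite sqr_l2norm; apply: eq_bigr => j _; rewrite expr2.
      by rewrite sqr_l2normD l2normN dotvNr (dotvC (g a y)); ring.
    under eq_bigr do rewrite zE.
    rewrite big_split sumrB /= sumr_const card_ord -mulr_sumr -dotv_sumr sum_g.
    by rewrite dotvZr -sqr_l2norm -mulr_natl; ring.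
  rewrite lerBlDr; apply: ler_wpDr; first by rewrite mulr_ge0 ?sqr_ge0.
  apply: sum_ord_le => a.
  rewrite ler_pXn2r ?nnegrE ?l2norm_ge0 // -(traj0 g eta 1%g y).
  exact: g_traj_bound.
rewrite (eq_avg E) avg_sum.
under eq_bigr do rewrite avgZ avg_sqr_perm_sum // sum1 sum2.
rewrite -mulr_sumr -!mulr_suml B2 -!(mulrA (eta ^+ 2)) ler_wpM2l ?sqr_ge0 //.
rewrite -(mulrA (\sum__ _)) -(mulrA (G ^+ 2)).
have n1 : 1 <= n%:R - 1 :> R by rewrite lerBrDr -(natrD R 1 1) ler_nat.
have n10 : 0 < n%:R - 1 :> R by lra.
have mle : n%:R * m%:R - m%:R ^+ 2 <= n%:R ^+ 2 / 4 :> R.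
  by have := sqr_ge0 (m%:R - n%:R / 2 : R); lra.
have m0 : 0 <= n%:R * m%:R - m%:R ^+ 2 :> R.
  by rewrite expr2 -mulrBl mulr_ge0 // subr_ge0 ler_nat.
have c0 : 0 <= (n%:R * (n%:R - 1))^-1 :> R by rewrite invr_ge0 mulr_ge0 // ltW.
apply: (@le_trans _ _ (n%:R * G ^+ 2 * ((n%:R * (n%:R - 1))^-1 * (n%:R ^+ 2 / 4)))).
  by apply: ler_pM; rewrite ?mulr_ge0 // ?ler_wpM2l //; do 2! apply: sumr_ge0 => ? _; exact: sqr_ge0.
have -> : n%:R * G ^+ 2 * ((n%:R * (n%:R - 1))^-1 * (n%:R ^+ 2 / 4)) =
    G ^+ 2 * (n%:R / 2 * (n%:R / 2 / (n%:R - 1))).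
  by field; rewrite !gt_eqF.
rewrite ler_wpM2l ?sqr_ge0 // ler_piMr ?divr_ge0 // ler_pdivrMr // mul1r; lra.
Qed.

Lemma avg_sqr_sum_fluct :
  avg (fun s => (\sum_(i < n) l2norm (fluct s i)) ^+ 2) <= (n%:R * B) ^+ 2.
Proof.
apply: (le_trans (le_avg (fun s => sqr_sum_le (fun i => l2norm (fluct s i))))).
rewrite avgZ avg_sum exprMn [n%:R ^+ 2]expr2 -mulrA ler_wpM2l //.
by apply: sum_ord_le => i; apply: avg_sqr_fluct; exact: ltnW.
Qed.

Lemma avg_drift_le : avg drift <= 32 / 31 * (n%:R * B + n%:R * (gam * L * r)).
Proof.
apply: (le_trans (le_avg drift_le_fluct)).
rewrite avgZ avgD avg_cst ?card_Sn_gt0 // ler_wpM2l // lerD2r.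
have U0 : 0 <= avg (fun s => \sum_(i < n) l2norm (fluct s i)).
  by apply: avg_ge0 => s; apply: sumr_ge0 => i _; exact: l2norm_ge0.
rewrite -(@ler_pXn2r _ 2) ?nnegrE ?U0 ?mulr_ge0 //.
exact: le_trans (sqr_avg_le (card_Sn_gt0 n) _) avg_sqr_sum_fluct.
Qed.

Lemma avg_sqr_drift_le : avg (fun s => drift s ^+ 2) <=
  (32 / 31) ^+ 2 * (2 * (n%:R * B) ^+ 2 + 2 * (n%:R * (gam * L * r)) ^+ 2).
Proof.
have le1 s : drift s ^+ 2 <= (32 / 31) ^+ 2 * (2 * (\sum_(i < n) l2norm (fluct s i)) ^+ 2 +
    2 * (n%:R * (gam * L * r)) ^+ 2).
  apply: (@le_trans _ _ ((32 / 31 * (\sum_(i < n) l2norm (fluct s i) + n%:R * (gam * L * r))) ^+ 2)).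
    by rewrite ler_pXn2r ?nnegrE ?drift_ge0 ?(le_trans (drift_ge0 s)) ?drift_le_fluct.
  rewrite exprMn ler_wpM2l ?sqr_ge0 //.
  by have := sqr_ge0 (\sum_(i < n) l2norm (fluct s i) - n%:R * (gam * L * r)); lra.
apply: (le_trans (le_avg le1)).
rewrite avgZ avgD avgZ avg_cst ?card_Sn_gt0 // ler_wpM2l ?sqr_ge0 // lerD2r ler_wpM2l //.
exact: avg_sqr_sum_fluct.
Qed.


Lemma growth_le k : (k <= n)%N -> (1 + eta * L) ^+ k <= 32 / 31.
Proof.
move=> kn; have -> : 32 / 31 = (1 - 1 / 32)^-1 :> R by field.
apply: (exp1D_le _ kn); first by rewrite mulr_ge0 // ltW.
  by rewrite mulrA [n%:R * _]mulrC -gamE.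
by lra.
Qed.

(** Up to position [m] the two runs agree; there two components differ and open a gap of at most
    [2 * eta * G]; afterwards the same components act, and each step stretches the gap by at most
    [1 + eta * L]. *)
Lemma swap_dist (s : 'S_n) (i m : 'I_n) k : (k <= i)%N ->
  l2norm (x_ s k - x_ (tperm i m * s)%g k) <= 2 * eta * G * (1 + eta * L) ^+ k.
Proof.
have c0 : 0 <= 2 * eta * G by rewrite !mulr_ge0 // ltW.
have q1 : 1 <= 1 + eta * L by rewrite lerDl mulr_ge0 // ltW.
elim: k => [|k IH] ki; first by rewrite !traj0 subrr l2norm0 mulr1.
have kn : (k < n)%N by exact: leq_trans ki (ltnW (ltn_ord i)).
pose o := Ordinal kn.
have io : i != o by apply: contraTneq ki => ->; rewrite -leqNgt.
rewrite (trajS _ _ s y o) (trajS _ _ (tperm i m * s)%g y o) /=.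
have [om|mo] := eqVneq m o.
  rewrite -(@eq_traj _ _ _ g eta s) ?(ltnW kn) //; last first.
    move=> j jk; rewrite permM tpermD //.
      by apply: contraTneq ki => ->; rewrite -leqNgt ltnW.
    by rewrite om; apply: contraTneq jk => <-; rewrite ltnn.
  rewrite opprB addrC subrKA -scalerBr l2normZ gtr0_norm //.
  have le1 := l2normB (g ((tperm i m * s)%g o) (x_ s k)) (g (s o) (x_ s k)).
  have le2 := g_traj_bound ((tperm i m * s)%g o) s (ltnW kn).
  have le3 := g_traj_bound (s o) s (ltnW kn).
  apply: (@le_trans _ _ (2 * eta * G)); last by rewrite ler_peMr // exprn_ege1.
  have : eta * l2norm (g ((tperm i m * s)%g o) (x_ s k) - g (s o) (x_ s k)) <= eta * (G + G).
    by rewrite ler_wpM2l ?(ltW eta0) // (le_trans le1) // lerD.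
  by lra.
rewrite permM tpermD //; set x := x_ s k; set x' := x_ _ k.
have -> : x - eta *: g (s o) x - (x' - eta *: g (s o) x') =
    (x - x') - eta *: (g (s o) x - g (s o) x').
  by rewrite scalerBr !opprB [_ - x']addrC addrACA [- _ + eta *: _]addrC.
rewrite (le_trans (l2normB _ _)) // l2normZ gtr0_norm // exprS.
have := IH (ltnW ki); rewrite -/x -/x' => IH'.
have le1 := ler_wpM2l (ltW eta0) (g_lip (s o) x x').
have : l2norm (x - x') * (1 + eta * L) <= 2 * eta * G * (1 + eta * L) ^+ k * (1 + eta * L).
  by rewrite ler_wpM2r // (le_trans _ q1).
by lra.
Qed.

(* Exchanging the positions i and m turns the component used at step i into a
   uniformly chosen one, while moving the iterate by O(eta G) only. *)
Lemma swap_gap w (i : 'I_n) :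
  avg (fun s : 'S_n => dotv w (g (s i) (x_ s i) - gF (x_ s i))) <=
  l2norm w * (L * (2 * eta * G * (32 / 31))).
Proof.
have c0 : 0 <= 2 * eta * G by rewrite !mulr_ge0 // ltW.
pose h m (s : 'S_n) := dotv w (g (s i) (x_ s i)) - dotv w (g (s m) (x_ s i)).
have E (s : 'S_n) : dotv w (g (s i) (x_ s i) - gF (x_ s i)) = n%:R^-1 * \sum_m h m s.
  apply: (mulfI (lt0r_neq0 nR_gt0)); rewrite mulVKf ?gt_eqF // /h sumrB.
  rewrite sumr_const card_ord -(@dotv_sumr R d _ predT w (fun m => g (s m) _)).
  rewrite sum_g_perm -[dotv _ _ *+ n]mulr_natl.
  by rewrite dotvBr dotvZr mulrBr.
rewrite (eq_avg E) avgZ avg_sum ler_pdivrMl //; apply: sum_ord_le => m.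
rewrite avgB -(avg_Mperm (tperm i m) (fun s => dotv w (g (s m) (x_ s i)))) -avgB.
apply: avg_le_cst => [|s]; first exact: card_Sn_gt0.
rewrite permM tpermR -dotvBr (le_trans (dotv_le _ _)) // ler_wpM2l ?l2norm_ge0 //.
rewrite (le_trans (g_lip _ _ _)) // ler_wpM2l ?(ltW L_gt0) //.
rewrite (le_trans (swap_dist _ _ (leqnn _))) // ler_wpM2l //.
by apply: growth_le; exact: ltnW.
Qed.

(** Splitting at [y + fluct s m] leaves a Lipschitz part, a Taylor remainder and a linear part of
    mean zero. Jensen's inequality with exponent [1 + nu <= 2] reduces the remainder to the variance
    bound. *)
Lemma mean_gap w m : (m <= n)%N ->
  avg (fun s : 'S_n => dotv w (gF (x_ s m) - gF y)) <=
  l2norm w * (L * (eta * L * avg drift + gam * L * r) + rho / (1 + nu) * B `^ (1 + nu)).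
Proof.
move=> mn.
have w0 := l2norm_ge0 w.
have le1 (s : 'S_n) : dotv w (gF (x_ s m) - gF y) <=
    l2norm w * (L * (eta * L * drift s + gam * L * r) +
      rho / (1 + nu) * l2norm (fluct s m) `^ (1 + nu)) + dotv (w *m (H y)^T) (fluct s m).
  set u := fluct s m; set x := x_ s m.
  have -> : gF x - gF y = (gF x - gF (y + u)) + (gF (y + u) - gF y - u *m H y) + u *m H y.
    by rewrite addrA subrK subrKA.
  rewrite 2!dotvDr dotv_mulmxr lerD2r mulrDr lerD //.
  rewrite (le_trans (dotv_le _ _)) // ler_wpM2l // (le_trans (gF_lip _ _)) //.
  rewrite ler_wpM2l ?(ltW L_gt0) // opprD addrA; exact: traj_fluct_le.
apply: (le_trans (le_avg le1)).
rewrite avgD avg_dotv_fluct addr0 avgZ ler_wpM2l // avgD avgZ avgD !avgZ.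
rewrite avg_cst ?card_Sn_gt0 // lerD2l ler_wpM2l ?divr_ge0 ?addr_ge0 ?(ltW nu0) //.
apply: avg_powR_le => //; first exact: card_Sn_gt0.
- by move=> s; exact: l2norm_ge0.
- by apply/andP; split; move: nu0 nu1; lra.
exact: avg_sqr_fluct.
Qed.

Lemma avg_dotv_err_le a : avg (fun s : 'S_n => dotv a (epoch_err s)) <=
  l2norm a * (gam * (L * (2 * eta * G * (32 / 31)) +
    (L * (eta * L * avg drift + gam * L * r) + rho / (1 + nu) * B `^ (1 + nu)))).
Proof.
rewrite -(l2normN a); set w := - a.
(* The minus sign of [epoch_err] is moved into [w]; the third piece has mean zero at every
   position. *)
have E (s : 'S_n) : dotv a (epoch_err s) = eta * \sum_i
    (dotv w (g (s i) (x_ s i) - gF (x_ s i)) + dotv w (gF (x_ s i) - gF y) -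
     dotv w (g (s i) y - gF y)).
  rewrite /epoch_err dotvZr mulNr -mulrN -dotvNl -/w dotv_sumr; congr (_ * _).
  apply: eq_bigr => i _; rewrite -dotvDr -dotvBr; congr dotv.
  by rewrite subrKA opprB subrKA.
rewrite (eq_avg E) avgZ avg_sum; set c := (X in _ <= _ * (gam * X)).
have -> : l2norm w * (gam * c) = eta * (n%:R * (l2norm w * c)) by rewrite gamE; ring.
rewrite ler_wpM2l ?(ltW eta0) //; apply: sum_ord_le => i.
rewrite avgB avgD /c mulrDr.
rewrite (avg_perm1 (fun a => dotv w (g a y - gF y))) -dotv_sumr.
rewrite sumrB sum_g sumr_const card_ord -[gF y *+ n]scaler_nat subrr.
rewrite dotv0r mulr0 subr0.
by apply: lerD; [exact: swap_gap | apply: mean_gap; exact: ltnW].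
Qed.

(** The square is expanded around the gradient step. Of its gain [63/32 * gam * mu], three uses of
    Young's inequality spend [6/5], the errors proportional to [r] spend less than [1/5], and more
    than [1/2] remains. *)
Lemma epoch_descent : avg (fun s : 'S_n => l2norm (x_ s n - xs) ^+ 2) <=
  (1 - gam * mu / 2) * r ^+ 2 +
  (32 * gam * (eta * G * L) ^+ 2 / mu + 6 * (gam * L * B) ^+ 2 +
   5 / 2 * gam / mu * (rho / (1 + nu) * B `^ (1 + nu)) ^+ 2).
Proof.
set a := y - gam *: gF y - xs; set b4 := rho / (1 + nu) * _.
have r0 : 0 <= r by exact: l2norm_ge0.
have b40 : 0 <= b4.
  by rewrite /b4 mulr_ge0 ?powR_ge0 // divr_ge0 // addr_ge0 // ltW.
have E (s : 'S_n) : l2norm (x_ s n - xs) ^+ 2 =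
    l2norm a ^+ 2 + (2 * dotv a (epoch_err s) + l2norm (epoch_err s) ^+ 2).
  by rewrite traj_err sqr_l2normD addrA.
rewrite (eq_avg E) avgD avg_cst ?card_Sn_gt0 // avgD avgZ.
have ar : l2norm a <= r.
  apply: le_trans gd_contract1 _; rewrite ler_piMl // gerBl mulr_ge0 //.
  by rewrite mulr_ge0 // ltW.
(* Errors due to the exchange of positions, to the fluctuation, and to the mean displacement; the
   last is charged to the contraction. *)
pose b1 := eta * G * L; pose b2 := gam * L ^+ 2 * B; pose b3 := gam * L ^+ 2 * r.
have b10 : 0 <= b1 by rewrite !mulr_ge0 // ltW.
have b20 : 0 <= b2 by rewrite !mulr_ge0 ?exprn_ge0 // ltW.
have b30 : 0 <= b3 by rewrite !mulr_ge0 ?exprn_ge0 // ltW.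
have inner : avg (fun s => dotv a (epoch_err s)) <=
    r * (gam * (64 / 31 * b1 + 32 / 31 * b2 + 32 / 31 * b3 + b3 + b4)).
  apply: le_trans (avg_dotv_err_le a) _.
  have dr0 : 0 <= avg drift by apply: avg_ge0 => s; exact: drift_ge0.
  have gLr0 : 0 <= gam * L * r by rewrite !mulr_ge0 // ltW.
  have k1 : 0 <= L * (2 * eta * G * (32 / 31)) by rewrite !mulr_ge0 // ltW.
  have k2 : 0 <= L * (eta * L * avg drift + gam * L * r).
    rewrite mulr_ge0 ?(ltW L_gt0) // addr_ge0 //.
    by rewrite mulr_ge0 // mulr_ge0 // ltW.
  apply: ler_pM => //; first exact: l2norm_ge0.
    rewrite mulr_ge0 ?(ltW gam_gt0) // addr_ge0 ?k1 // addr_ge0 ?k2 //.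
  rewrite ler_wpM2l ?(ltW gam_gt0) // -/b4.
  have c0 : 0 <= L * (eta * L) by rewrite !mulr_ge0 // ltW.
  have := ler_wpM2l c0 avg_drift_le.
  have -> : L * (eta * L) * (32 / 31 * (n%:R * B + n%:R * (gam * L * r))) =
      32 / 31 * b2 + 32 / 31 * (gam * L * b3).
    by rewrite /b2 /b3 gamE; field.
  move: (ler_wpM2r b30 gamL) (b30).
  have -> : b3 = L * (gam * L * r) by rewrite /b3; ring.
  rewrite /b1 => h1 h2 h3; lra.
have err : avg (fun s => l2norm (epoch_err s) ^+ 2) <=
    (32 / 31) ^+ 2 * 2 * ((gam * L * B) ^+ 2 + (gam * L) ^+ 2 * (gam * L) ^+ 2 * r ^+ 2).
  apply: (@le_trans _ _ (avg (fun s => (eta * L) ^+ 2 * drift s ^+ 2))).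
    apply: le_avg => s; rewrite -exprMn ler_pXn2r ?nnegrE ?l2norm_ge0 ?epoch_err_le //.
    by rewrite !mulr_ge0 ?drift_ge0 // ltW.
  rewrite avgZ (le_trans (ler_wpM2l (sqr_ge0 _) avg_sqr_drift_le)) //.
  by rewrite gamE le_eqVlt; apply/orP; left; apply/eqP; ring.
(* Young's inequality, with the same weight for each of the three error terms. *)
have young b : 2 * (r * (gam * b)) <= 2 / 5 * (gam * mu * r ^+ 2) + 5 / 2 * (gam / mu * b ^+ 2).
  have h : 0 <= gam / mu * (2 * mu * r - 5 * b) ^+ 2.
    by rewrite mulr_ge0 ?sqr_ge0 // divr_ge0 // ltW.
  have : gam / mu * (2 * mu * r - 5 * b) ^+ 2 =
      4 * (gam * mu * r ^+ 2) - 20 * (r * (gam * b)) + 25 * (gam / mu * b ^+ 2).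
    by field; rewrite gt_eqF.
  by move: h => /[swap] ->; lra.
have gr0 : 0 <= gam * mu * r ^+ 2 by rewrite !mulr_ge0 ?sqr_ge0 // ltW.
have gm0 : 0 <= gam / mu by rewrite divr_ge0 // ltW.
have Y1 := young (64 / 31 * b1).
have Y2 := young (32 / 31 * b2).
have Y4 := young b4.
have Z2 : gam / mu * b2 ^+ 2 <= 1 / 32 * (gam * L * B) ^+ 2.
  have -> : gam / mu * b2 ^+ 2 = (gam * L ^+ 2) / mu * (gam * L * B) ^+ 2.
    by rewrite /b2; field; rewrite gt_eqF.
  by rewrite ler_wpM2r ?sqr_ge0 // ler_pdivrMr //; move: gamL2; lra.
have Z3 : r * (gam * b3) <= 1 / 32 * (gam * mu * r ^+ 2).
  have -> : r * (gam * b3) = (gam * L) ^+ 2 * r ^+ 2 by rewrite /b3; ring.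
  by have := ler_wpM2r (sqr_ge0 r) gam2L2; lra.
have Z5 : (gam * L) ^+ 2 * (gam * L) ^+ 2 * r ^+ 2 <= 1 / 32 * (gam * mu * r ^+ 2).
  have c1 : (gam * L) ^+ 2 <= 1.
    by have := gam2L2; move: gammu; lra.
  have : (gam * L) ^+ 2 * (gam * L) ^+ 2 <= gam * mu / 32.
    by apply: le_trans gam2L2; rewrite ler_piMl ?sqr_ge0.
  by move/(ler_wpM2r (sqr_ge0 r)); lra.
have Z1 : 0 <= gam / mu * b1 ^+ 2 by rewrite mulr_ge0 ?sqr_ge0.
have Z6 : 0 <= (gam * L * B) ^+ 2 by exact: sqr_ge0.
have GD : l2norm a ^+ 2 <= (1 - 2 * gam * mu + gam * mu / 32) * r ^+ 2.
  apply: le_trans (gd_contract y) _; rewrite ler_wpM2r ?sqr_ge0 //.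
  by move: gam2L2; lra.
have -> : 32 * gam * (eta * G * L) ^+ 2 / mu = 32 * (gam / mu * b1 ^+ 2).
  by rewrite /b1; field; rewrite gt_eqF.
have -> : 5 / 2 * gam / mu * b4 ^+ 2 = 5 / 2 * (gam / mu * b4 ^+ 2) by field; rewrite gt_eqF.
move: inner err Y1 Y2 Y4 Z2 Z3 Z5 GD; rewrite !exprMn.
move: gr0 Z1 Z6; rewrite !exprMn; lra.
Qed.

End FixedStart.
End Epoch.

(** * Iterating over the epochs *)

Section RandomReshuffling.
Variables (R : realType) (d n : nat) (f : 'I_n -> 'rV[R]_d -> R) (eta : R).

(** The first epoch is split off, not the last: [rr_iterate] folds from the left, so the remaining
    epochs form a run from a new starting point. *)
Definition ffun_cons (K : nat) (ps : 'S_n * {ffun 'I_K -> 'S_n}) :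
    {ffun 'I_K.+1 -> 'S_n} :=
  [ffun k => if unlift ord0 k is Some j then ps.2 j else ps.1].

Lemma ffun_cons_bij K : bijective (@ffun_cons K).
Proof.
exists (fun s : {ffun 'I_K.+1 -> 'S_n} => (s ord0, [ffun k : 'I_K => s (lift ord0 k)])).
  move=> [p s]; rewrite /ffun_cons; congr pair; first by rewrite ffunE unlift_none.
  by apply/ffunP => k; rewrite !ffunE liftK.
move=> s; apply/ffunP => k; rewrite ffunE.
by case: unliftP => [j|] ->; rewrite //= ffunE.
Qed.

Lemma rr_iterate_cons K p (s : {ffun 'I_K -> 'S_n}) y :
  rr_iterate f eta y (ffun_cons (p, s)) = rr_iterate f eta (rr_epoch f eta p y) s.
Proof.
rewrite /rr_iterate enum_ordSl /= ffunE unlift_none /=.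
elim: (enum 'I_K) (rr_epoch f eta p y) => [|k e IH] z; first by [].
by rewrite map_cons 2![foldl _ _ (_ :: _)]/= ffunE liftK IH.
Qed.

(** Independence of the epochs: the uniform law on sequences is a product. Inductions on [K]
    therefore quantify over the starting point. *)
Lemma rr_expectS K (Phi : 'rV[R]_d -> R) y :
  rr_expect (fun s : {ffun 'I_K.+1 -> 'S_n} => Phi (rr_iterate f eta y s)) =
  avg (fun p : 'S_n => rr_expect (fun s : {ffun 'I_K -> 'S_n} =>
    Phi (rr_iterate f eta (rr_epoch f eta p y) s))).
Proof.
rewrite /rr_expect /avg -mulr_sumr mulrA -invfM -natrM; congr (_%:R^-1 * _).
  by rewrite !card_ffun !card_ord expnS mulnC.
rewrite (reindex (@ffun_cons K)) /=; last exact/onW_bij/ffun_cons_bij.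
rewrite pair_bigA /=; apply: eq_bigr => -[p s] _.
by rewrite rr_iterate_cons.
Qed.

Lemma rr_expect0 (Phi : 'rV[R]_d -> R) y :
  rr_expect (fun s : {ffun 'I_0 -> 'S_n} => Phi (rr_iterate f eta y s)) = Phi y.
Proof.
rewrite -[RHS](@avg_cst _ {ffun 'I_0 -> 'S_n}); last first.
  by rewrite card_ffun card_ord expn0.
by apply: eq_avg => s; rewrite /rr_iterate enum_ord0.
Qed.

End RandomReshuffling.

Lemma sqr_powR (R : realType) (x p : R) : 0 <= x -> (x `^ p) ^+ 2 = (x ^+ 2) `^ p.
Proof.
move=> x0; rewrite -(powR_mulrn 2 (powR_ge0 x p)) -(powR_mulrn 2 x0).
exact: powRAC.
Qed.

Lemma powR_sqr (R : realType) (x nu : R) : 0 <= x ->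
  (x ^+ 2) `^ (1 + nu) = x `^ (2 + 2 * nu).
Proof. by move=> x0; rewrite -powR_mulrn // -powRrM mulrDr mulr1. Qed.

Lemma sum_geom_le (R : realType) (q : R) K : 0 <= q -> (1 - q) * \sum_(k < K) q ^+ k <= 1.
Proof. by move=> q0; rewrite -opprB mulNr -subrX1 opprB lerBlDr lerDl exprn_ge0. Qed.

(** * Mean squared distance after K epochs *)

Section UpperBound.
Variables (R : realType) (L mu rho nu : R) (d n K : nat).
Variables (f : 'I_n -> 'rV[R]_d -> R) (xs : 'rV[R]_d).
Hypotheses (adm : admissible_params L mu rho nu).
Hypotheses (cls : problem_class L mu rho nu f xs) (n2 : (2 <= n)%N).

Let F := average f.
Let mu0 : 0 < mu. Proof. by have [/andP[]] := adm. Qed.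
Let muL : mu <= L. Proof. by have [/andP[]] := adm. Qed.
Let nu0 : 0 < nu. Proof. by have [_ /andP[]] := adm. Qed.
Let nu1 : nu <= 1. Proof. by have [_ /andP[]] := adm. Qed.
Let rho0 : 0 <= rho. Proof. by have [_ _] := adm. Qed.
Let L0 : 0 < L. Proof. exact: lt_le_trans muL. Qed.

Let df i x : differentiable (f i) x.
Proof. by have [/(_ i) [h _] _ _ _] := cls; exact: h. Qed.

Let dF x : differentiable F x.
Proof. exact: differentiable_average. Qed.

Lemma grad_average_xs : grad F xs = 0.
Proof. by apply: grad_minimizer => //; have [_ _ [h _] _] := cls. Qed.

Lemma grad_average_mono x :
  mu * l2norm (x - xs) ^+ 2 <= dotv (x - xs) (grad F x).
Proof.
have [_ sc _ _] := cls.
(* Adding the inequalities in both directions cancels the function values and doubles [mu / 2]. *)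
have h1 := strongly_convex_grad xs (ltW mu0) sc (dF x).
have h2 := strongly_convex_grad x (ltW mu0) sc (dF xs).
move: h1 h2; rewrite grad_average_xs dotv0r.
by rewrite (l2normC xs) -(opprB x xs) dotvNl; rewrite -/F; lra.
Qed.

Lemma grad_average_lip x y : l2norm (grad F x - grad F y) <= L * l2norm (x - y).
Proof.
apply: (@gF_lip _ d n (fun i => grad (f i)) (grad F) L) => //.
- by move=> z; apply: grad_average => i; exact: df.
- by move=> i; have [/(_ i) [_ h] _ _ _] := cls; exact: h.
Qed.

(** Convexity bounds the gap by [dotv (x - xs) (grad F x)]; Cauchy-Schwarz and the Lipschitz
    gradient finish. The loss against [L / 2] is invisible in the rate. *)
Lemma average_gap_le x : F x - F xs <= L * l2norm (x - xs) ^+ 2.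
Proof.
have [_ sc _ _] := cls.
have := strongly_convex_grad xs (ltW mu0) sc (dF x).
have : 0 <= mu / 2 * l2norm (xs - x) ^+ 2 by rewrite mulr_ge0 ?sqr_ge0 // divr_ge0 // ltW.
have := dotv_le (x - xs) (grad F x).
have := grad_average_lip x xs; rewrite grad_average_xs subr0.
move=> /(ler_wpM2l (l2norm_ge0 (x - xs))).
by rewrite -(opprB x xs) dotvNl -/F; lra.
Qed.

Variable y0 : 'rV[R]_d.
Let D := Dconst L f xs y0.
Let G := Gconst L f xs y0.

Lemma Gstar_le_D : Gstar f xs <= 2 * L * D.
Proof.
have : Gstar f xs / (2 * L) <= D by rewrite /D /Dconst le_max lexx orbT.
by rewrite ler_pdivrMr ?mulr_gt0 // mulrC.
Qed.

Lemma y0_le_D : l2norm (y0 - xs) <= D.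
Proof. by rewrite /D /Dconst le_max lexx. Qed.

Lemma Gconst_ge0 : 0 <= G.
Proof.
have D0 : 0 <= D := le_trans (l2norm_ge0 _) y0_le_D.
rewrite /G /Gconst addr_ge0 // ?mulr_ge0 ?(ltW L0) //.
rewrite /Gstar; elim/big_ind: _ => // [x y x0 _|i _]; last exact: l2norm_ge0.
by rewrite le_max x0.
Qed.

Section Step.
Variables (eta gam B : R).
Hypotheses (eta0 : 0 < eta) (gamE : gam = eta * n%:R) (gamL2 : gam * L ^+ 2 <= mu / 32).
Hypotheses (B0 : 0 <= B) (B2 : B ^+ 2 = eta ^+ 2 * G ^+ 2 * n%:R / 2).

Let S := 32 * gam * (eta * G * L) ^+ 2 / mu + 6 * (gam * L * B) ^+ 2 +
   5 / 2 * gam / mu * (rho / (1 + nu) * B `^ (1 + nu)) ^+ 2.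

Lemma rr_epoch_descent y : l2norm (y - xs) <= D ->
  (forall s, l2norm (rr_epoch f eta s y - xs) <= D) /\
  avg (fun s => l2norm (rr_epoch f eta s y - xs) ^+ 2) <=
    (1 - gam * mu / 2) * l2norm (y - xs) ^+ 2 + S.
Proof.
move=> yD.
have lip i u v : l2norm (grad (f i) u - grad (f i) v) <= L * l2norm (u - v).
  by have [/(_ i) [_ h] _ _ _] := cls; exact: h.
have gs i : l2norm (grad (f i) xs) <= Gstar f xs.
  by rewrite /Gstar; exact: (le_bigmax _ (fun i => l2norm (grad (f i) xs))).
have [_ _ _ hol] := cls.
split=> [s|].
  rewrite rr_epochE.
  exact: (@epoch_invariant _ d n (fun i => grad (f i)) (grad F) L mu eta gam
    (Gstar f xs) D G xs n2 mu0 muL eta0 gamE gamL2 (fun x => grad_average (df^~ x))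
    lip gs Gstar_le_D erefl grad_average_xs grad_average_mono y yD s).
under eq_avg do rewrite rr_epochE.
exact: (@epoch_descent _ d n (fun i => grad (f i)) (grad F) (hessian F) L mu rho nu
  eta gam (Gstar f xs) D G xs n2 mu0 muL nu0 nu1 rho0 eta0 gamE gamL2
  (fun x => grad_average (df^~ x))
    lip gs Gstar_le_D erefl grad_average_xs grad_average_mono
  (fun y u w => holder_hessian_taylor y u w nu0 hol) y yD B B0 B2).
Qed.

Lemma rr_sqdist_geom k y : l2norm (y - xs) <= D ->
  rr_sqdist k f eta xs y <= (1 - gam * mu / 2) ^+ k * l2norm (y - xs) ^+ 2 +
    S * \sum_(j < k) (1 - gam * mu / 2) ^+ j.
Proof.
have q0 : 0 <= 1 - gam * mu / 2.
  have gmu : gam * mu <= 1 / 32.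
    rewrite -(ler_pM2r mu0) -mulrA -expr2; apply: (@le_trans _ _ (gam * L ^+ 2)).
      by rewrite gamE ler_wpM2l ?mulr_ge0 ?(ltW eta0) // ler_pXn2r ?nnegrE ?(ltW mu0) ?(ltW L0).
    by move: gamL2; lra.
  by lra.
elim: k y => [|k IH] y yD.
  rewrite /rr_sqdist (rr_expect0 f eta (fun x => l2norm (x - xs) ^+ 2)).
  by rewrite big_ord0 mulr0 addr0 expr0 mul1r.
rewrite /rr_sqdist (rr_expectS f eta k (fun x => l2norm (x - xs) ^+ 2)).
have [inv desc] := rr_epoch_descent yD.
apply: (le_trans (le_avg (fun p => IH _ (inv p)))).
rewrite avgD (avgZ (_ ^+ k)) avg_cst ?card_Sn_gt0 // big_ord_recr /= mulrDr.
have := ler_wpM2l (exprn_ge0 k q0) desc; rewrite [_ ^+ k.+1]exprSr -/S.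
by lra.
Qed.

End Step.
End UpperBound.

(** * The explicit bound for the prescribed stepsize *)

Section Bound.
Variables (R : realType).
Implicit Types (L mu rho nu : R).

(** The left side is the Hölder error of an epoch divided by [gam * mu / 2]. Since [B ^+ 2] is
    [8 * (l * G) ^+ 2 * N / (mu * T) ^+ 2], a factor [8^(1 + nu)] appears. *)
Lemma holder_term_le (rho nu G N l mu T eta B : R) :
  0 < nu <= 1 -> 0 <= rho -> 0 <= G -> 0 < N -> 0 < l -> 0 < mu -> 0 < T ->
  eta = 4 * l / (mu * T) -> 0 <= B -> B ^+ 2 = eta ^+ 2 * G ^+ 2 * N / 2 ->
  5 / mu ^+ 2 * (rho / (1 + nu) * B `^ (1 + nu)) ^+ 2 <=
  2 `^ (7 + 2 * nu) / (1 + nu) ^+ 2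
        * (rho ^+ 2 * G `^ (2 + 2 * nu) * N `^ (1 + nu)
             * l `^ (2 + 2 * nu)
           / (mu `^ (4 + 2 * nu) * T `^ (2 + 2 * nu))).
Proof.
move=> /andP[nu0 nu1] rho0 G0 N0 l0 mu0 T0 etaE B0 B2.
have q0 : 0 < 1 + nu by rewrite addr_gt0.
have muT : 0 < mu * T by rewrite mulr_gt0.
have key : (B `^ (1 + nu)) ^+ 2 * (mu `^ (2 + 2 * nu) * T `^ (2 + 2 * nu)) =
    8 `^ (1 + nu) * (G `^ (2 + 2 * nu) * N `^ (1 + nu) * l `^ (2 + 2 * nu)).
  rewrite sqr_powR // -!powR_sqr ?(ltW mu0) ?(ltW T0) ?(ltW l0) //.
  rewrite -!powRM ?mulr_ge0 ?sqr_ge0 ?(ltW N0) ?(ltW mu0) ?(ltW l0) ?(ltW T0) //.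
  by congr powR; rewrite B2 etaE; field; rewrite !gt_eqF.
have mu4 : mu `^ (4 + 2 * nu) = mu ^+ 2 * mu `^ (2 + 2 * nu).
  rewrite -powR_mulrn ?(ltW mu0) // -powRD; first by congr powR; ring.
  by rewrite (gt_eqF mu0) implybT.
(* The right side is [2^(4 - nu) * 8^(1 + nu)], and [2^(4 - nu) >= 8] as [nu <= 1]. *)
have five : 5 * 8 `^ (1 + nu) <= 2 `^ (7 + 2 * nu) :> R.
  have -> : (8 : R) = 2 `^ 3 by rewrite powR_mulrn // -natrX.
  rewrite -powRrM.
  have -> : 7 + 2 * nu = (4 - nu) + 3 * (1 + nu) by ring.
  rewrite [leRHS]powRD; last by rewrite pnatr_eq0 implybT.
  rewrite ler_wpM2r ?powR_ge0 //.
  apply: (@le_trans _ _ (2 `^ 3%:R)); first by rewrite powR_mulrn // -natrX ler_nat.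
  by rewrite ler_powR ?ler1n //; lra.
have m0 : 0 < mu `^ (2 + 2 * nu) * T `^ (2 + 2 * nu) by rewrite mulr_gt0 ?powR_gt0.
have -> : 5 / mu ^+ 2 * (rho / (1 + nu) * B `^ (1 + nu)) ^+ 2 =
  rho ^+ 2 / (mu ^+ 2 * (1 + nu) ^+ 2 * (mu `^ (2 + 2 * nu) * T `^ (2 + 2 * nu))) *
  (5 * ((B `^ (1 + nu)) ^+ 2 * (mu `^ (2 + 2 * nu) * T `^ (2 + 2 * nu)))).
  by field; rewrite !gt_eqF ?powR_gt0.
rewrite key mu4.
set X := G `^ _ * _ * _.
have X0 : 0 <= X by rewrite !mulr_ge0 ?powR_ge0.
have -> : 2 `^ (7 + 2 * nu) / (1 + nu) ^+ 2 * (rho ^+ 2 * G `^ (2 + 2 * nu) * N `^ (1 + nu)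
             * l `^ (2 + 2 * nu)
           / (mu ^+ 2 * mu `^ (2 + 2 * nu) * T `^ (2 + 2 * nu))) =
  rho ^+ 2 / (mu ^+ 2 * (1 + nu) ^+ 2 * (mu `^ (2 + 2 * nu) * T `^ (2 + 2 * nu))) *
   (2 `^ (7 + 2 * nu) * X).
  by rewrite /X; field; rewrite !gt_eqF ?powR_gt0.
apply: ler_wpM2l; last by rewrite mulrA ler_wpM2r.
by rewrite divr_ge0 ?sqr_ge0 // mulr_ge0 ?(ltW m0) // mulr_ge0 ?sqr_ge0.
Qed.

(** Rests on [exp(1/2) <= 2]. With [2 * ln T >= 1], lower powers of the logarithm are absorbed by
    higher ones. *)
Lemma ln_ge_half (T : R) : 3 <= T -> 1 / 2 <= ln T.
Proof.
move=> T3; have T0 : 0 < T by lra.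
rewrite -ler_expR lnK ?posrE //.
have e0 : 0 < expR (1 / 2) :> R := expR_gt0 _.
have := expR_ge1Dx (- (1 / 2) : R); rewrite expRN => h.
have : (1 + - (1 / 2)) * expR (1 / 2) <= 1 :> R.
  by rewrite -ler_pdivlMr // [leRHS]div1r.
by lra.
Qed.

Lemma rr_sqdist_bound L mu rho nu (d n K : nat) (f : 'I_n -> 'rV[R]_d -> R)
      (xs y0 : 'rV[R]_d) :
  admissible_params L mu rho nu -> problem_class L mu rho nu f xs ->
  rr_regime L mu n K ->
  let T : R := (n * K)%:R in
  let D := Dconst L f xs y0 in
  let G := Gconst L f xs y0 in
  rr_sqdist K f (rr_stepsize mu n K) xs y0 <=
    D ^+ 2 / T ^+ 2
    + 1024 * L ^+ 2 * G ^+ 2 * ln T ^+ 2 / (mu ^+ 4 * T ^+ 2)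
    + 384 * L ^+ 2 * G ^+ 2 * n%:R ^+ 2 * ln T ^+ 3 / (mu ^+ 4 * T ^+ 3)
    + 2 `^ (7 + 2 * nu) / (1 + nu) ^+ 2
      * (rho ^+ 2 * G `^ (2 + 2 * nu) * n%:R `^ (1 + nu)
           * ln T `^ (2 + 2 * nu)
         / (mu `^ (4 + 2 * nu) * T `^ (2 + 2 * nu))).
Proof.
move=> adm cls [n2 K1 T3 reg]; cbv zeta.
set T : R := (n * K)%:R; set D := Dconst L f xs y0; set G := Gconst L f xs y0.
have [/andP[mu0 muL] nu01 rho0] := adm.
have L0 : 0 < L := lt_le_trans mu0 muL.
have T3R : 3 <= T by rewrite (ler_nat R 3).
have T0 : 0 < T by lra.
have l0 : 0 < ln T by have := ln_ge_half T3R; lra.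
have N0 : 0 < n%:R :> R by rewrite ltr0n; case: (n) n2.
have K0 : 0 < K%:R :> R by rewrite ltr0n.
have TE : T = n%:R * K%:R by rewrite /T natrM.
have : rr_stepsize mu n K = 4 * ln T / (mu * T) by [].
move: (rr_stepsize mu n K) => eta etaE.
have eta0 : 0 < eta by rewrite etaE divr_gt0 ?mulr_gt0.
have gamE : 4 * ln T / (mu * K%:R) = eta * n%:R.
  by rewrite etaE TE; field; rewrite !gt_eqF.
have [gam gamD] : exists gam, gam = 4 * ln T / (mu * K%:R) by eexists.
rewrite -gamD in gamE.
have gam0 : 0 < gam by rewrite gamE mulr_gt0.
(* The assumption on [K] rewritten: 128 is the 4 of the stepsize times 32. *)
have gamL2 : gam * L ^+ 2 <= mu / 32.
  have -> : gam * L ^+ 2 = mu / 32 * (128 * (L ^+ 2 / mu ^+ 2) * ln T) / K%:R.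
    by rewrite gamD; field; rewrite !gt_eqF.
  by rewrite ler_pdivrMr // ler_wpM2l // divr_ge0 // ltW.
pose B := eta * G * Num.sqrt (n%:R / 2).
have G0 : 0 <= G := Gconst_ge0 f xs adm y0.
have B0 : 0 <= B by rewrite mulr_ge0 ?sqrtr_ge0 // mulr_ge0 // ltW.
have B2 : B ^+ 2 = eta ^+ 2 * G ^+ 2 * n%:R / 2.
  by rewrite /B !exprMn sqr_sqrtr ?divr_ge0 ?(ltW N0) // mulrA.
have := rr_sqdist_geom adm cls n2 eta0 gamE gamL2 B0 B2 K (y0_le_D L f xs y0).
rewrite -/G -/D; set q := 1 - gam * mu / 2; set S := (X in _ + X * \sum_(_ < _) _) => main.
have gmu0 : 0 < gam * mu / 2 by rewrite divr_gt0 ?mulr_gt0.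
have q0 : 0 <= q.
  have : gam * mu * mu <= mu / 32.
    apply: le_trans gamL2; rewrite -mulrA -expr2 ler_wpM2l ?(ltW gam0) //.
    by rewrite ler_pXn2r ?nnegrE ?(ltW mu0) ?(ltW L0).
  have -> : mu / 32 = 1 / 32 * mu by field.
  by rewrite ler_pM2r // /q; lra.
(* This fixes the 4 in the stepsize: [K * gam * mu / 2 = 2 * ln T]. *)
have qK : q ^+ K <= (T ^+ 2)^-1.
  apply: (@le_trans _ _ (expR (- (gam * mu / 2)) ^+ K)).
    by rewrite lerXn2r ?nnegrE ?expR_ge0 // /q expR_ge1Dx.
  rewrite -expRM_natl -[X in _ <= X^-1](@lnK _ (T ^+ 2)) ?posrE ?exprn_gt0 //.
  rewrite -expRN ler_expR lnXn // le_eqVlt; apply/orP; left; apply/eqP.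
  by rewrite gamD -[ln T *+ 2]mulr_natl; field; rewrite !gt_eqF.
have S0 : 0 <= S.
  have gm : 0 <= gam / mu by rewrite divr_ge0 // ltW.
  have -> : S = 32 * (gam / mu * (eta * G * L) ^+ 2) + 6 * (gam * L * B) ^+ 2 +
      5 / 2 * (gam / mu * (rho / (1 + nu) * B `^ (1 + nu)) ^+ 2).
    by rewrite /S; set b := _ / _ * B `^ _; field; rewrite gt_eqF.
  apply: addr_ge0; first by apply: addr_ge0; rewrite mulr_ge0 // ?sqr_ge0 // mulr_ge0 ?sqr_ge0.
  by rewrite mulr_ge0 // mulr_ge0 ?sqr_ge0.
have first : q ^+ K * l2norm (y0 - xs) ^+ 2 <= D ^+ 2 / T ^+ 2.
  rewrite [leRHS]mulrC ler_pM ?exprn_ge0 ?sqr_ge0 ?l2norm_ge0 //.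
  by rewrite lerXn2r ?nnegrE ?l2norm_ge0 ?(le_trans (l2norm_ge0 _) (y0_le_D L f xs y0)) ?y0_le_D.
have second : S * \sum_(j < K) q ^+ j <= S / (gam * mu / 2).
  rewrite ler_wpM2l // -[leRHS]mul1r ler_pdivlMr // mulrC.
  by have := sum_geom_le K q0; rewrite {1}/q opprB addrC subrK.
(* The division leaves [64 * eta ^+ 2] and [6 * eta ^+ 3 * n ^+ 2] as leading factors, whence
   [64 * 4^2 = 1024] and [6 * 4^3 = 384]. *)
have SE : S / (gam * mu / 2) =
    1024 * L ^+ 2 * G ^+ 2 * ln T ^+ 2 / (mu ^+ 4 * T ^+ 2)
    + 384 * L ^+ 2 * G ^+ 2 * n%:R ^+ 2 * ln T ^+ 3 / (mu ^+ 4 * T ^+ 3)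
    + 5 / mu ^+ 2 * (rho / (1 + nu) * B `^ (1 + nu)) ^+ 2.
  rewrite /S [(gam * L * B) ^+ 2]exprMn B2 gamE etaE; set b := _ / _ * B `^ _.
  by field; rewrite !gt_eqF.
have hol := holder_term_le nu01 rho0 G0 N0 l0 mu0 T0 etaE B0 B2.
by move: main second hol first; rewrite SE; lra.
Qed.

End Bound.

(** * Function-value rates *)

Section Rates.
Variable R : realType.

Lemma rr_gap_le_sqdist (L mu rho nu eta : R) (d n K : nat)
    (f : 'I_n -> 'rV[R]_d -> R) (xs y0 : 'rV[R]_d) :
  admissible_params L mu rho nu -> problem_class L mu rho nu f xs -> (2 <= n)%N ->
  rr_gap K f eta xs y0 <= L * rr_sqdist K f eta xs y0.
Proof.
move=> adm cls n2; rewrite /rr_sqdist -[rr_expect _]/(avg _) -avgZ.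
by apply: le_avg => s; exact: average_gap_le adm cls n2 _.
Qed.

(** After cancellation this is [n * K^3 <= n^(1 + nu) * K^(2 + 2 nu)]; the exponent of [K] asks for
    [nu >= 1/2]. *)
Lemma holder_rate_le (nu : R) (n K : nat) :
  2^-1 <= nu <= 1 -> (2 <= n)%N -> (1 <= K)%N ->
  n%:R `^ (1 + nu) * (n * K)%:R `^ (- (2 + 2 * nu)) <=
  n%:R ^+ 2 * (n * K)%:R ^- 3.
Proof.
move=> /andP[nu2 nu1] n2 K1.
have n1 : 1 <= n%:R :> R by rewrite ler1n ltnW.
have k1 : 1 <= K%:R :> R by rewrite ler1n.
have n0 : 0 < n%:R :> R := lt_le_trans ltr01 n1.
have k0 : 0 < K%:R :> R := lt_le_trans ltr01 k1.
have T0 : 0 < (n * K)%:R :> R by rewrite natrM mulr_gt0.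
rewrite powRN ler_pdivrMr ?powR_gt0 // mulrAC ler_pdivlMr ?exprn_gt0 //.
rewrite natrM (powRM _ (ltW n0) (ltW k0)) exprMn.
rewrite -[in leRHS]powR_sqr ?(ltW n0) // -sqr_powR ?(ltW n0) //.
have kle : K%:R ^+ 3 <= K%:R `^ (2 + 2 * nu) :> R.
  by rewrite -powR_mulrn ?(ltW k0) // ler_powR //; lra.
have nle : n%:R <= n%:R `^ (1 + nu) :> R.
  by rewrite -[leLHS]powRr1 ?(ltW n0) // ler_powR //; lra.
set A := n%:R `^ (1 + nu) in nle *; set B := K%:R `^ _ in kle *.
have A0 : 0 <= A by exact: powR_ge0.
have -> : A * (n%:R ^+ 3 * K%:R ^+ 3) = (n%:R ^+ 2 * A) * (n%:R * K%:R ^+ 3) by ring.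
have -> : n%:R ^+ 2 * (A ^+ 2 * B) = (n%:R ^+ 2 * A) * (A * B) by ring.
rewrite ler_wpM2l ?mulr_ge0 ?exprn_ge0 ?(ltW n0) //.
by rewrite ler_pM ?mulr_ge0 ?exprn_ge0 ?(ltW n0) ?(ltW k0).
Qed.

(** The exponent 4 is the largest value of [2 + 2 * nu]; all powers of the logarithm are bounded by
    [(2 * ln T)^4]. The summand 1 in the constant only makes it positive. *)
Lemma rr_gap_rate : rr_gap_tildeO (fun _ : R => True)
    (fun nu n K => let T : R := (n * K)%:R in
       T ^- 2 + n%:R ^+ 2 * T ^- 3
       + n%:R `^ (1 + nu) * T `^ (- (2 + 2 * nu))).
Proof.
exists 4 => L mu rho nu G D adm _.
have [/andP[mu0 muL] /andP[nu0 nu1] rho0] := adm.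
have L0 : 0 < L := lt_le_trans mu0 muL.
pose c := 2 `^ (7 + 2 * nu) / (1 + nu) ^+ 2 * (rho ^+ 2 * G `^ (2 + 2 * nu) / mu `^ (4 + 2 * nu)).
have c0 : 0 <= c.
  by apply: mulr_ge0; apply: divr_ge0; rewrite ?powR_ge0 ?sqr_ge0 // mulr_ge0 ?powR_ge0 ?sqr_ge0.
pose b := 1024 * L ^+ 2 * G ^+ 2 / mu ^+ 4.
have b0 : 0 <= b.
  apply: divr_ge0; last by rewrite exprn_ge0 // ltW.
  by apply: mulr_ge0; [apply: mulr_ge0; [exact: ler0n | exact: sqr_ge0] | exact: sqr_ge0].
exists (L * (16 * (D ^+ 2 + b + c)) + 1) => [|d n K f xs y0 cls reg DE GE].
  by apply: ltr_wpDl => //; rewrite mulr_ge0 ?(ltW L0) // mulr_ge0 // addr_ge0 // addr_ge0 // sqr_ge0.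
have [n2 K1 T3 _] := reg.
have := rr_sqdist_bound y0 adm cls reg; cbv zeta; rewrite DE GE.
move/(ler_wpM2l (ltW L0)) => bound.
cbv beta zeta; apply: (le_trans (rr_gap_le_sqdist _ K y0 adm cls n2)).
apply: (le_trans bound).
have T3R : 3 <= (n * K)%:R :> R by rewrite (ler_nat R 3).
have G0 : 0 <= G by rewrite -GE; exact: Gconst_ge0 f xs adm y0.
have n0 : 0 <= n%:R :> R by [].
move: (n%:R : R) ((n * K)%:R : R) T3R n0 => N T T3R N0 {bound}.
have T0 : 0 < T by lra.
have l2 : 1 <= 2 * ln T by have := ln_ge_half T3R; lra.
have l0 : 0 < ln T by lra.
have l41 : 1 <= 16 * ln T ^+ 4.
  have -> : 16 * ln T ^+ 4 = (2 * ln T) ^+ 4 by ring.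
  exact: exprn_ege1.
have l42 : ln T ^+ 2 <= 16 * ln T ^+ 4.
  have -> : 16 * ln T ^+ 4 = (2 * (2 * ln T) ^+ 2 * 2) * ln T ^+ 2 by ring.
  rewrite -[leLHS]mul1r ler_wpM2r ?sqr_ge0 //.
  by have := exprn_ege1 2 l2; lra.
have l43 : ln T ^+ 3 <= 16 * ln T ^+ 4.
  have -> : 16 * ln T ^+ 4 = (8 * (2 * ln T)) * ln T ^+ 3 by ring.
  by rewrite -[leLHS]mul1r ler_wpM2r ?exprn_ge0 ?(ltW l0) //; lra.
have l44 : ln T `^ (2 + 2 * nu) <= 16 * ln T ^+ 4.
  have -> : 16 * ln T ^+ 4 = (2 * ln T) `^ 4%:R.
    by rewrite powR_mulrn ?mulr_ge0 ?(ltW l0) //; ring.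
  apply: (@le_trans _ _ ((2 * ln T) `^ (2 + 2 * nu))).
    by apply: ge0_ler_powR; rewrite ?nnegrE; lra.
  by rewrite ler_powR //; lra.
set l4 := ln T ^+ 4 in l41 l42 l43 l44 *; set P := ln T `^ _ in l44 *.
have l40 : 0 <= l4 by rewrite exprn_ge0 // ltW.
have i2 : 0 <= T ^- 2 by rewrite invr_ge0 exprn_ge0 // ltW.
have i3 : 0 <= N ^+ 2 * T ^- 3 by rewrite mulr_ge0 ?sqr_ge0 // invr_ge0 exprn_ge0 // ltW.
have iX : 0 <= N `^ (1 + nu) * T `^ (- (2 + 2 * nu)) by rewrite mulr_ge0 ?powR_ge0.
have t1 : D ^+ 2 / T ^+ 2 <= 16 * l4 * D ^+ 2 * T ^- 2.
  rewrite ler_wpM2r // -[leLHS]mul1r ler_wpM2r ?sqr_ge0 //.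
have t2 : 1024 * L ^+ 2 * G ^+ 2 * ln T ^+ 2 / (mu ^+ 4 * T ^+ 2) <= 16 * l4 * b * T ^- 2.
  have -> : 1024 * L ^+ 2 * G ^+ 2 * ln T ^+ 2 / (mu ^+ 4 * T ^+ 2) =
      ln T ^+ 2 * b * T ^- 2 by rewrite /b; field; rewrite !gt_eqF.
  by rewrite ler_wpM2r // ler_wpM2r.
have t3 : 384 * L ^+ 2 * G ^+ 2 * N ^+ 2 * ln T ^+ 3 / (mu ^+ 4 * T ^+ 3) <=
    16 * l4 * b * (N ^+ 2 * T ^- 3).
  have -> : 384 * L ^+ 2 * G ^+ 2 * N ^+ 2 * ln T ^+ 3 / (mu ^+ 4 * T ^+ 3) =
      3 / 8 * (ln T ^+ 3 * b * (N ^+ 2 * T ^- 3)) by rewrite /b; field; rewrite !gt_eqF.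
  have : ln T ^+ 3 * b * (N ^+ 2 * T ^- 3) <= 16 * l4 * b * (N ^+ 2 * T ^- 3).
    by rewrite ler_wpM2r // ler_wpM2r.
  have : 0 <= ln T ^+ 3 * b * (N ^+ 2 * T ^- 3).
    by apply: mulr_ge0 => //; apply: mulr_ge0 => //; rewrite exprn_ge0 // ltW.
  by lra.
have t4 : 2 `^ (7 + 2 * nu) / (1 + nu) ^+ 2
        * (rho ^+ 2 * G `^ (2 + 2 * nu) * N `^ (1 + nu) * P
           / (mu `^ (4 + 2 * nu) * T `^ (2 + 2 * nu))) <=
     16 * l4 * c * (N `^ (1 + nu) * T `^ (- (2 + 2 * nu))).
  rewrite powRN [X in X <= _](_ : _ = P * c * (N `^ (1 + nu) / T `^ (2 + 2 * nu))).
    by rewrite -powRN ler_wpM2r // ler_wpM2r.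
  by rewrite /c; field; rewrite !gt_eqF ?powR_gt0 // addr_gt0.
set i2' := T ^- 2 in i2 t1 t2 *; set i3' := N ^+ 2 * T ^- 3 in i3 t3 *.
set iX' := N `^ _ * T `^ _ in iX t4 *.
have k (x y : R) : 0 <= x -> 0 <= y -> 0 <= 16 * l4 * x * y.
  by move=> x0 y0'; rewrite mulr_ge0 // mulr_ge0 // mulr_ge0.
have k0 (x : R) : 0 <= x -> 0 <= l4 * x by exact: mulr_ge0.
have main : L * (16 * l4 * D ^+ 2 * i2' + 16 * l4 * b * i2' + 16 * l4 * b * i3' + 16 * l4 * c * iX')
   <= L * ((16 * (D ^+ 2 + b + c)) * l4 * (i2' + i3' + iX')).
  rewrite ler_wpM2l ?(ltW L0) //.
  have := k _ _ (sqr_ge0 D) i3; have := k _ _ (sqr_ge0 D) iX.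
  have := k _ _ b0 iX; have := k _ _ c0 i2; have := k _ _ c0 i3.
  by lra.
have sum4 := ler_wpM2l (ltW L0) (lerD (lerD (lerD t1 t2) t3) t4).
apply: le_trans sum4 (le_trans main _).
have := k0 _ (addr_ge0 (addr_ge0 i2 i3) iX).
by lra.
Qed.

Lemma rr_gap_rate_half : rr_gap_tildeO (fun nu : R => 2^-1 <= nu)
    (fun _ n K => let T : R := (n * K)%:R in
       T ^- 2 + n%:R ^+ 2 * T ^- 3).
Proof.
have [p H] := rr_gap_rate.
exists p => L mu rho nu G D adm nu2.
have [C C0 HC] := H L mu rho nu G D adm I.
exists (2 * C) => [|d n K f xs y0 cls reg DE GE]; first by rewrite mulr_gt0.
apply: le_trans (HC d n K f xs y0 cls reg DE GE) _.
have [n2 K1 T3 _] := reg; have [_ /andP[_ nu1] _] := adm.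
have nu21 : 2^-1 <= nu <= 1 by rewrite nu2.
have := holder_rate_le nu21 n2 K1; cbv zeta => cmp.
have c0 : 0 <= C * ln (n * K)%:R ^+ p.
  by rewrite mulr_ge0 ?(ltW C0) // exprn_ge0 // ln_ge0 // ler1n (leq_trans _ T3).
have -> : 2 * C * ln (n * K)%:R ^+ p * ((n * K)%:R ^- 2 + n%:R ^+ 2 * (n * K)%:R ^- 3) =
    C * ln (n * K)%:R ^+ p * (2 * ((n * K)%:R ^- 2 + n%:R ^+ 2 * (n * K)%:R ^- 3)) by ring.
rewrite ler_wpM2l //.
have : 0 <= (n * K)%:R ^- 2 :> R by rewrite invr_ge0 exprn_ge0.
by move: cmp; lra.
Qed.

End Rates.

(** * Quadratic instances *)

Lemma eq_from_mulmx (R : realType) (d : nat) (B C : 'M[R]_d) :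
  (forall w : 'rV[R]_d, w *m B = w *m C) -> B = C.
Proof. by move=> BC; apply/row_matrixP => i; rewrite !rowE. Qed.

Lemma eq_derive_increment (R : realType) (V W : normedModType R) (g : V -> W) u v w :
  (forall h : R, g (h *: w + u) - g u = g (h *: w + v) - g v) ->
  'D_w g u = 'D_w g v.
Proof.
move=> guv; rewrite /derive.
have -> : (fun h : R => h^-1 *: ((g \o shift u) (h *: w) - g u)) =
          (fun h : R => h^-1 *: ((g \o shift v) (h *: w) - g v)).
  by apply/funext => h /=; rewrite guv.
by [].
Qed.

Section Quadratic.
Variables (R : realType) (d : nat) (A : 'M[R]_d) (b : 'rV[R]_d) (c : R).
Implicit Types (x u v : 'rV[R]_d).

Definition quad x : R :=
  2^-1 * (x *m A *m x^T) ord0 ord0 + (x *m b^T) ord0 ord0 + c.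

(** [is_quadratic] allows any [A], so gradient and minimizer depend on its symmetric part. *)
Definition sympart : 'M[R]_d := 2^-1 *: (A + A^T).

Lemma quadE x : quad x = 2^-1 * dotv (x *m A) x + dotv x b + c.
Proof.
rewrite /quad; congr (_ * _ + _ + _); rewrite mxE;
by apply: eq_bigr => j _; rewrite [_^T _ _]mxE.
Qed.

Lemma sympart_dotv v : dotv (v *m sympart) v = dotv (v *m A) v.
Proof.
have -> : v *m sympart = 2^-1 *: (v *m A + v *m A^T).
  by rewrite -mulmxDr scalemxAr.
rewrite dotvZl dotvDl [dotv (v *m A^T) v]dotvC dotv_mulmxr trmxK; lra.
Qed.

Lemma quad_line x v (h : R) : quad (x + h *: v) - quad x =
  h * (dotv v (x *m sympart + b) + 2^-1 * dotv (v *m A) v * h).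
Proof.
rewrite !quadE mulmxDl -scalemxAl !(dotvDl, dotvDr, dotvZl, dotvZr).
have -> : dotv v (x *m sympart) = 2^-1 * (dotv (x *m A) v + dotv (v *m A) x).
  have -> : x *m sympart = 2^-1 *: (x *m A + x *m A^T).
    by rewrite -mulmxDr scalemxAr.
  by rewrite dotvZr dotvDr (dotvC v) [dotv v (x *m A^T)]dotv_mulmxr trmxK.
by ring.
Qed.

Lemma differentiable_mulmx (B : 'M[R]_d) x : differentiable (fun u : 'rV[R]_d => u *m B) x.
Proof.
have -> : (fun u : 'rV[R]_d => u *m B) = \sum_i (fun u : 'rV[R]_d => u ord0 i *: row i B).
  by apply/funext => u; rewrite fct_sumE mulmx_sum_row.
apply: differentiable_sum => i; apply: differentiableZl; exact: differentiable_coord.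
Qed.

Lemma differentiable_dotv (f g : 'rV[R]_d -> 'rV[R]_d) x :
  differentiable f x -> differentiable g x -> differentiable (fun u => dotv (f u) (g u)) x.
Proof.
move=> df dg.
have co (h : 'rV[R]_d -> 'rV[R]_d) j : differentiable h x -> differentiable (fun u => h u ord0 j) x.
  move=> dh; pose e (M : 'rV[R]_d) := M ord0 j.
  exact: (@differentiable_comp _ _ _ _ h e x dh (differentiable_coord (h x) ord0 j)).
have -> : (fun u => dotv (f u) (g u)) =
    \sum_j (fun u => f u ord0 j) * (fun u => g u ord0 j).
  by apply/funext => u; rewrite fct_sumE.
by apply: differentiable_sum => j; apply: differentiableM; exact: co.
Qed.

Lemma differentiable_quad x : differentiable quad x.
Proof.
have -> : quad = 2^-1 *: (fun u => dotv (u *m A) u) + (fun u => dotv u b) + cst c.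
  by apply/funext => u; rewrite quadE.
apply: differentiableD; last exact: differentiable_cst.
apply: differentiableD; last by apply: differentiable_dotv => //; exact: differentiable_cst.
by apply: differentiableZ; apply: differentiable_dotv => //; exact: differentiable_mulmx.
Qed.

Lemma grad_quad x : grad quad x = x *m sympart + b.
Proof.
have D v : 'D_v quad x = dotv v (x *m sympart + b).
  have dq := diff_derivable (v := v) (differentiable_quad x).
  set k := 2^-1 * dotv (v *m A) v.
  (* [quad_line] is exact, so the one-sided estimate applies to [quad] and to [- quad]. *)
  apply/eqP; rewrite eq_le; apply/andP; split.
    apply: (derive_le_of_right dq (normr_ge0 k)) => h /andP[h0 _].
    rewrite quad_line ler_wpM2l ?(ltW h0) // lerD2l ler_wpM2r ?(ltW h0) //.
    exact: ler_norm.
  rewrite -lerN2 -deriveN //.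
  apply: (derive_le_of_right (derivableN dq) (normr_ge0 k)).
  move=> h /andP[h0 _].
  have -> : (- quad) (x + h *: v) - (- quad) x = - (quad (x + h *: v) - quad x).
    by rewrite /= opprB opprK addrC.
  rewrite quad_line -mulrN ler_wpM2l ?(ltW h0) // opprD lerD2l -mulNr.
  by rewrite ler_wpM2r ?(ltW h0) // -normrN ler_norm.
apply/rowP => j; rewrite mxE D /dotv (bigD1 j) //= mxE !eqxx mul1r big1 ?addr0 //.
by move=> i ij; rewrite mxE eqxx (negbTE ij) mul0r.
Qed.

Lemma differentiable_grad_quad x : differentiable (grad quad) x.
Proof.
have -> : grad quad = (fun u => u *m sympart) + cst b.
  by apply/funext => u; rewrite grad_quad.
by apply: differentiableD; [exact: differentiable_mulmx | exact: differentiable_cst].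
Qed.

Lemma hessian_quad u v : hessian quad u = hessian quad v.
Proof.
have H w z : w *m hessian quad z = 'D_w (grad quad) z.
  by rewrite (deriveEjacobian w (differentiable_grad_quad z)).
have E w z (h : R) : grad quad (h *: w + z) - grad quad z = h *: w *m sympart.
  by rewrite !grad_quad mulmxDl opprD addrACA subrr addr0 addrK.
have DE w : 'D_w (grad quad) u = 'D_w (grad quad) v.
  by apply: eq_derive_increment => h; rewrite (E w u) (E w v).
have WE (w : 'rV[R]_d) : w *m hessian quad u = w *m hessian quad v.
  exact: etrans (H w u) (etrans (DE w) (esym (H w v))).
move: (hessian quad u) (hessian quad v) WE => B C.
exact: eq_from_mulmx.
Qed.

Lemma holder_hessian_quad (rho nu : R) : 0 <= rho -> holder_hessian rho nu quad.
Proof.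
move=> rho0; split; [exact: differentiable_quad|exact: differentiable_grad_quad|].
by move=> u v; rewrite (hessian_quad u v) subrr opnorm0 mulr_ge0 ?powR_ge0.
Qed.

Section StronglyConvex.
Variable mu : R.
Hypotheses (mu0 : 0 < mu) (sc : strongly_convex mu quad).

(** At the midpoint of [v] and 0 the linear and constant terms cancel, leaving [1/8] of the
    claim. *)
Lemma quad_coercive v : mu * l2norm v ^+ 2 <= dotv (v *m A) v.
Proof.
have half : 0 <= (2^-1 : R) <= 1 by lra.
have := sc v 0 half; rewrite scaler0 addr0 subr0 !quadE -scalemxAl.
rewrite !dotvZl !dotvZr mul0mx !dotv0l.
by lra.
Qed.

Lemma sympart_unit : sympart \in unitmx.
Proof.
rewrite -row_free_unit -kermx_eq0; apply/eqP/row_matrixP => i; rewrite row0.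
set v := row i _; have vM : v *m sympart = 0 by rewrite -row_mul mulmx_ker row0.
have := quad_coercive v; rewrite -sympart_dotv vM dotv0l.
rewrite pmulr_rle0 // => v0; apply: l2norm_eq0; apply/eqP.
by rewrite -sqrf_eq0 eq_le v0 sqr_ge0.
Qed.

Lemma quad_minimizer : exists xs, unique_minimizer quad xs.
Proof.
(* The stationary point: [quad_line] has no linear term there, and the remaining quadratic growth
   gives both minimality and uniqueness. *)
pose xs := - (b *m invmx sympart); exists xs.
have low v : mu / 2 * l2norm v ^+ 2 <= quad (xs + v) - quad xs.
  rewrite -[v in quad (_ + v)]scale1r quad_line /xs mulNmx mulmxKV ?sympart_unit //.
  rewrite addNr dotv0r add0r mul1r mulr1.
  by have := quad_coercive v; lra.
have lowx x : mu / 2 * l2norm (x - xs) ^+ 2 <= quad x - quad xs.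
  by have := low (x - xs); rewrite [xs + _]addrC subrK.
split=> [x|z minz].
  have := lowx x; have : 0 <= mu / 2 * l2norm (x - xs) ^+ 2.
    by rewrite mulr_ge0 ?sqr_ge0 // divr_ge0 // ltW.
  by lra.
apply/eqP; rewrite -subr_eq0; apply/eqP/l2norm_eq0/eqP.
rewrite -sqrf_eq0 eq_le sqr_ge0 andbT -(pmulr_rle0 _ (divr_gt0 mu0 (ltr0Sn R 1))).
by apply: (le_trans (lowx z)); rewrite subr_le0.
Qed.

End StronglyConvex.

End Quadratic.

Lemma quadratic_average (R : realType) (d n : nat) (f : 'I_n -> 'rV[R]_d -> R) :
  (forall i, is_quadratic (f i)) -> exists A b c, average f = quad A b c.
Proof.
move=> fq.
have [p pf] : exists p : 'I_n -> 'M[R]_d * 'rV[R]_d * R,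
    forall i, f i = quad (p i).1.1 (p i).1.2 (p i).2.
  have fq' i : exists q, f i = quad q.1.1 q.1.2 q.2; last first.
    by have [p pE] := boolp.choice fq'; exists p.
  have [A [b [c fE]]] := fq i.
  by exists (A, b, c); apply/funext => x; rewrite fE.
exists (n%:R^-1 *: \sum_i (p i).1.1), (n%:R^-1 *: \sum_i (p i).1.2), (n%:R^-1 * \sum_i (p i).2).
apply/funext => x; rewrite /average quadE -scalemxAr dotvZl dotvZr mulmx_sumr.
rewrite dotvC !dotv_sumr mulrCA -!mulrDr; congr (_ * _).
rewrite mulr_sumr -!big_split /=; apply: eq_bigr => i _.
by rewrite pf quadE (dotvC x (x *m _)).
Qed.

Lemma quadratic_problem_class (R : realType) (L mu rho nu : R) (d n : nat)
    (f : 'I_n -> 'rV[R]_d -> R) :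
  admissible_params L mu rho nu ->
  (forall i, is_quadratic (f i)) ->
  (forall i, lipschitz_grad L (f i)) ->
  strongly_convex mu (average f) ->
  exists xs : 'rV[R]_d, problem_class L mu rho nu f xs.
Proof.
move=> [/andP[mu0 _] _ rho0] fq fl sc; have [A [b [c fE]]] := quadratic_average fq.
have [xs xsP] : exists xs, unique_minimizer (average f) xs.
  by rewrite fE; apply: (@quad_minimizer _ _ _ _ _ mu) => //; rewrite -fE.
by exists xs; split=> //; rewrite fE; exact: holder_hessian_quad.
Qed.

(** * Dynamics of one coordinate *)

Section CoordinateDynamics.
Variables (R : realType) (d n : nat) (f : 'I_n -> 'rV[R]_d -> R) (eta : R).
Variables (j : 'I_d) (h b : 'I_n -> R).
Hypothesis gradE : forall i x, grad (f i) x ord0 j = h i * x ord0 j + b i.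

(** The same for every permutation, so only the additive part of an epoch is random. *)
Definition decay : R := \prod_(i < n) (1 - eta * h i).

(** The damping that the shift added at step [i] undergoes in the rest of the epoch. *)
Definition later (s : 'S_n) (i : 'I_n) : R := \prod_(l < n | (i < l)%N) (1 - eta * h (s l)).

Definition noise (s : 'S_n) : R := \sum_(i < n) b (s i) * later s i.

Lemma rr_epoch_coord s y :
  rr_epoch f eta s y ord0 j = decay * y ord0 j - eta * noise s.
Proof.
pose X m := traj (fun i => grad (f i)) eta s y m ord0 j.
(* The current value is multiplied by all factors still to come, so each step only adds its own
   damped shift. *)
have H m : (m <= n)%N ->
  (\prod_(l < n | (m <= l)%N) (1 - eta * h (s l))) * X m =
  decay * y ord0 j - eta * \sum_(i < n | (i < m)%N) b (s i) * later s i.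
  elim: m => [_|m IH mn].
    rewrite big_ord_lt0 mulr0 subr0 /X traj0 /decay [in RHS](reindex_inj (@perm_inj _ s)).
    by congr (_ * _).
  have := IH (ltnW mn); pose o := Ordinal mn.
  rewrite (bigD1 o) //= (eq_bigl (fun l : 'I_n => (m < l)%N)); last first.
    by move=> l; rewrite ltn_neqAle andbC -(inj_eq val_inj) /= eq_sym.
  rewrite (big_ord_ltS _ o) /= => IH'.
  rewrite [X m.+1](_ : _ = (1 - eta * h (s o)) * X m - eta * b (s o)); last first.
    have coord (u v : 'rV[R]_d) : (u - eta *: v) ord0 j = u ord0 j - eta * v ord0 j.
      by rewrite !mxE.
    by rewrite /X (trajS _ _ s y o) coord gradE /=; ring.
  by rewrite mulrBr mulrA [_ * (1 - _)]mulrC IH' /later /=; ring.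
have := H n (leqnn n); rewrite big_ord_ltn big_pred0 => [|l]; last first.
  by rewrite leqNgt ltn_ord.
by rewrite mul1r /X -rr_epochE.
Qed.

Lemma rr_expect_coord K y :
  rr_expect (fun s : {ffun 'I_K -> 'S_n} => rr_iterate f eta y s ord0 j) =
  decay ^+ K * y ord0 j - eta * avg noise * \sum_(k < K) decay ^+ k.
Proof.
elim: K y => [|K IH] y.
  by rewrite (rr_expect0 f eta (fun x => x ord0 j)) big_ord0 mulr0 subr0 mul1r.
rewrite (rr_expectS f eta K (fun x => x ord0 j)).
under eq_avg => p do rewrite IH rr_epoch_coord.
rewrite avgB avg_cst ?card_Sn_gt0 // avgZ avgB avg_cst ?card_Sn_gt0 // avgZ.
by rewrite big_ord_recr /= exprSr; ring.
Qed.

Lemma rr_expect_sqr_coord K y : avg noise = 0 ->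
  rr_expect (fun s : {ffun 'I_K -> 'S_n} => rr_iterate f eta y s ord0 j ^+ 2) =
  (decay ^+ 2) ^+ K * y ord0 j ^+ 2 +
  eta ^+ 2 * avg (fun s => noise s ^+ 2) * \sum_(k < K) (decay ^+ 2) ^+ k.
Proof.
move=> noise0; elim: K y => [|K IH] y.
  by rewrite (rr_expect0 f eta (fun x => x ord0 j ^+ 2)) big_ord0 mulr0 addr0 mul1r.
rewrite (rr_expectS f eta K (fun x => x ord0 j ^+ 2)).
under eq_avg => p.
  rewrite IH rr_epoch_coord (_ : (decay * y ord0 j - eta * noise p) ^+ 2 =
    (decay * y ord0 j) ^+ 2 + (- (2 * decay * y ord0 j * eta) * noise p + eta ^+ 2 * noise p ^+ 2)).
    over.
  by ring.
rewrite avgD [avg (fun=> _ * \sum_(_ < _) _)]avg_cst ?card_Sn_gt0 //.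
rewrite (avgZ (_ ^+ K)) avgD avg_cst ?card_Sn_gt0 // avgD !avgZ noise0.
by rewrite big_ord_recr /= [_ ^+ K.+1]exprSr; ring.
Qed.

End CoordinateDynamics.

(** * Bias from the correlation of curvature and shift *)

Section Bias.
Variables (R : realType) (n : nat) (eta kappa : R) (h : 'I_n -> R).
Hypotheses (eta0 : 0 < eta) (later_ge : forall s i, kappa <= later eta h s i).

(* Exchanging the labels al and be places be where al was, with the
   multiplicative factor 1 - 2 eta exactly when al comes first. *)
Lemma avg_later_gap (al be : 'I_n) : al != be -> h al = 2 -> h be = 0 ->
  eta * kappa <= avg (fun s : 'S_n => later eta h s ((s^-1)%g al)) -
                 avg (fun s : 'S_n => later eta h s ((s^-1)%g be)).
Proof.
move=> ab hal hbe; pose t := tperm al be.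
pose first (s : 'S_n) : R := ((s^-1)%g al < (s^-1)%g be)%N%:R.
have first_half : avg first = 1 / 2.
  have : avg first + avg first = 1.
    rewrite -{2}(avg_permM t) -avgD -[RHS](avg_cst (card_Sn_gt0 n)); apply: eq_avg => s.
    rewrite /first invMg tpermV !permM tpermL tpermR.
    have : (s^-1)%g al != (s^-1)%g be by rewrite (inj_eq perm_inj).
    by rewrite -(inj_eq val_inj) neq_ltn /= => /orP[] lt; rewrite lt ltnNge ltnW //= ?addr0 ?add0r.
  lra.
rewrite -(avg_permM t (fun s : 'S_n => later eta h s ((s^-1)%g be))) -avgB.
have -> : eta * kappa = avg (fun s => 2 * eta * kappa * first s).
  by rewrite avgZ first_half; lra.
apply: le_avg => s; rewrite invMg tpermV permM tpermR.
set i := (s^-1)%g al; rewrite /first -/i.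
have si : s i = al by rewrite /i permKV.
pose o := (s^-1)%g be; have so : s o = be by rewrite /o permKV.
have rest : forall l, l != o -> (i < l)%N -> h ((s * t)%g l) = h (s l).
  move=> l lo il; rewrite permM tpermD //.
    by rewrite -si (inj_eq perm_inj); apply: contraTneq il => ->; rewrite ltnn.
  by rewrite -so (inj_eq perm_inj) eq_sym.
(* If [be] comes first, neither product meets a changed factor. Otherwise they differ at [o] only,
   by [1] against [1 - 2 * eta], and the common rest equals [later eta h s i]. *)
rewrite /later; have [io|oi] := ltnP i o; last first.
  rewrite mulr0 subr_ge0 le_eqVlt; apply/orP; left; apply/eqP/eq_bigr => l il.
  by rewrite rest //; apply: contraTneq il => ->; rewrite -leqNgt.
have restE : \prod_(l < n | (i < l)%N && (l != o)) (1 - eta * h ((s * t)%g l)) =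
    \prod_(l < n | (i < l)%N && (l != o)) (1 - eta * h (s l)).
  by apply: eq_bigr => l /andP[il lo]; rewrite rest.
have := later_ge s i; rewrite /later !(bigD1 o io) /= restE permM so tpermR hal hbe.
by move=> /(ler_wpM2l (ltW eta0)); lra.
Qed.

Lemma noise_later (b : 'I_n -> R) s :
  noise eta h b s = \sum_e b e * later eta h s ((s^-1)%g e).
Proof.
rewrite /noise [RHS](reindex_inj (@perm_inj _ s)); apply: eq_bigr => i _.
by rewrite permK.
Qed.

(** Multiplied by [p], the difference of the two sums becomes a sum over all [p ^ 2] pairs of
    labels, each bounded by [avg_later_gap]. *)
Lemma avg_noise_ge (b : 'I_n -> R) (S0 S1 : {set 'I_n}) (p : nat) :
  (0 < p)%N -> #|S0| = p -> #|S1| = p -> (forall e, e \in S0 -> e \notin S1) ->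
  (forall e, b e = (e \in S0)%:R - (e \in S1)%:R) ->
  (forall e, e \in S0 -> h e = 2) -> (forall e, e \in S1 -> h e = 0) ->
  p%:R * (eta * kappa) <= avg (noise eta h b).
Proof.
move=> p0 c0 c1 dis bE h2 h0.
pose W e := avg (fun s : 'S_n => later eta h s ((s^-1)%g e)).
have NE : avg (noise eta h b) = \sum_(e in S0) W e - \sum_(e in S1) W e.
  rewrite (eq_avg (noise_later b)) avg_sum !(big_mkcond (fun e => e \in _)) -sumrB.
  apply: eq_bigr => e _; rewrite avgZ bE mulrBl.
  by case: (e \in S0); case: (e \in S1); rewrite ?mul1r ?mul0r.
have pR : 0 < p%:R :> R by rewrite ltr0n.
rewrite NE -(ler_pM2l pR).
have -> : p%:R * (\sum_(e in S0) W e - \sum_(e in S1) W e) =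
    \sum_(al in S0) \sum_(be in S1) (W al - W be).
  under [RHS]eq_bigr do rewrite sumrB sumr_const c1.
  by rewrite sumrB sumr_const c0 sumrMnl -mulrnBl -[RHS]mulr_natl.
have -> : p%:R * (p%:R * (eta * kappa)) = \sum_(al in S0) \sum_(be in S1) (eta * kappa).
  under [RHS]eq_bigr do rewrite sumr_const c1.
  by rewrite sumr_const c0 -mulrnA -[RHS]mulr_natl natrM mulrA.
apply: ler_sum => al a0; apply: ler_sum => be b1; apply: avg_later_gap; [|exact: h2|exact: h0].
by apply: contraTneq b1 => <-; exact: dis.
Qed.

End Bias.

(** * Products, geometric sums and the variance of the noise *)

Section Products.
Variables (R : realType).

Lemma prod_1B_bounds n (x : 'I_n -> R) : (forall i, 0 <= x i <= 1) ->
  1 - \sum_i x i <= \prod_i (1 - x i) <= expR (- \sum_i x i) /\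
  0 <= \prod_i (1 - x i) <= 1 /\ 0 <= \sum_i x i.
Proof.
move=> x01; elim/big_rec2: _ => [|i P S _ [/andP[lo hi] [/andP[P0 P1] S0]]].
  by rewrite subr0 oppr0 expR0 !lexx ler01.
have /andP[xi0 xi1] := x01 i.
have e0 : 0 <= expR (- S) := expR_ge0 _.
split; last by split; [apply/andP; split; nra | lra].
apply/andP; split; first by nra.
rewrite opprD expRD ler_pM //; first lra.
exact: expR_ge1Dx.
Qed.

(** The sum times [1 - P] is [1 - P ^+ K], and [P ^+ K <= exp(-1/32) <= 32/33]. The threshold [1/32]
    matches the lower end of the stepsizes left by coordinate 0. *)
Lemma sum_geom_ge (P z : R) (K : nat) :
  0 <= P -> 1 - P <= z -> P <= expR (- z) -> 0 < z -> 1 / 32 <= z * K%:R ->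
  1 <= 33 * z * \sum_(k < K) P ^+ k.
Proof.
move=> P0 P1 Pe z0 zK.
have PK : P ^+ K <= 32 / 33.
  apply: (@le_trans _ _ (expR (- z) ^+ K)); first by rewrite lerXn2r ?nnegrE ?expR_ge0.
  rewrite -expRM_natr mulNr expRN -[leRHS]invrK lef_pV2 ?posrE ?expR_gt0 ?invr_gt0 //.
  have := expR_ge1Dx (z * K%:R).
  have -> : (32 / 33)^-1 = 33 / 32 :> R by field.
  by lra.
have S0 : 0 <= \sum_(k < K) P ^+ k by apply: sumr_ge0 => k _; rewrite exprn_ge0.
have : (1 - P) * \sum_(k < K) P ^+ k = 1 - P ^+ K.
  by rewrite -[1 - P]opprB mulNr -subrX1 opprB.
have := ler_wpM2r S0 P1; lra.
Qed.

(** For [eta <= 1/4], [(1 + 4 eta) * (1 - 2 eta) >= 1], hence [1 - 2 eta >= exp(- 4 eta)]; the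
    exponent is then at most [4 * 4]. *)
Lemma pow_ge_kappa (eta : R) (n m : nat) : 0 < eta <= 1 / 4 -> n%:R * eta <= 4 ->
  (m <= n)%N -> expR (- 16) <= (1 - 2 * eta) ^+ m.
Proof.
move=> /andP[e0 e1] ne mn.
have e4 : expR (- (4 * eta)) <= 1 - 2 * eta.
  rewrite expRN -[leRHS]invrK lef_pV2 ?posrE ?expR_gt0 ?invr_gt0 //; last lra.
  apply: le_trans (expR_ge1Dx _); rewrite -[leLHS]mul1r ler_pdivrMr; last lra.
  by nra.
apply: (@le_trans _ _ (expR (- (4 * eta)) ^+ m)); last first.
  by rewrite lerXn2r ?nnegrE ?expR_ge0 //; lra.
rewrite -expRM_natr ler_expR.
have : m%:R * eta <= n%:R * eta by rewrite ler_wpM2r ?ler_nat // ltW.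
by lra.
Qed.

Lemma later_ge (eta : R) (n : nat) (h : 'I_n -> R) s i :
  0 < eta <= 1 / 4 -> n%:R * eta <= 4 -> (forall i, 0 <= h i <= 2) ->
  expR (- 16) <= later eta h s i.
Proof.
move=> e ne h2; have /andP[e0 e1] := e.
apply: le_trans (pow_ge_kappa e ne (_ : #|[pred l : 'I_n | (i < l)%N]| <= n)%N) _.
  by rewrite -[leqRHS]card_ord max_card.
rewrite -prodr_const /later; apply: ler_prod => l _.
by have /andP[h0' h2'] := h2 (s l); apply/andP; split; nra.
Qed.

Lemma sum_ord_natr n : \sum_(i < n) (i%:R : R) = n%:R * (n%:R - 1) / 2.
Proof.
elim: n => [|n IH]; first by rewrite big_ord0 !mul0r.
by rewrite big_ord_recr /= IH -natr1; field.
Qed.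

Lemma sum_ord_sqrr n : \sum_(i < n) (i%:R ^+ 2 : R) = n%:R * (n%:R - 1) * (2 * n%:R - 1) / 6.
Proof.
elim: n => [|n IH]; first by rewrite big_ord0 !mul0r.
by rewrite big_ord_recr /= IH -natr1; field.
Qed.

Lemma sum_sqr_diff n (x : 'I_n -> R) :
  \sum_i \sum_j (x i - x j) ^+ 2 = 2 * (n%:R * \sum_i x i ^+ 2 - (\sum_i x i) ^+ 2).
Proof.
have row i : \sum_j (x i - x j) ^+ 2 =
    n%:R * x i ^+ 2 + (\sum_j x j ^+ 2 - 2 * (\sum_j x j) * x i).
  transitivity (\sum_j (x i ^+ 2 + (x j ^+ 2 - 2 * x j * x i))).
    by apply: eq_bigr => j _; ring.
  rewrite big_split sumrB /= sumr_const card_ord -[x i ^+ 2 *+ n]mulr_natl.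
  by rewrite -mulr_suml -mulr_sumr.
under eq_bigr do rewrite row.
rewrite big_split sumrB /= -!mulr_sumr sumr_const card_ord.
by rewrite -[(\sum_j _) *+ n]mulr_natl; ring.
Qed.

End Products.

(** * Variance of geometric weights *)

Section Variance.
Variables (R : realType) (n : nat) (eta : R).
Hypotheses (n2 : (2 <= n)%N) (eta0 : 0 < eta) (eta4 : eta <= 1 / 4).
Let q := 1 - eta.

(** By [sum_sqr_diff] both sides are sums over pairs. Consecutive powers differ by [eta * q ^+ s],
    at least [kappa * eta], so the powers spread at least like [kappa * eta] times their indices. *)
Lemma sum_pow_diff_small : n%:R * eta <= 4 ->
  expR (- 16) ^+ 2 * eta ^+ 2 * (n%:R ^+ 2 * (n%:R ^+ 2 - 1) / 12) <=
  n%:R * \sum_(i < n) (q ^+ i) ^+ 2 - (\sum_(i < n) q ^+ i) ^+ 2.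
Proof.
move=> ne; set kappa := expR (- 16).
have k0 : 0 < kappa := expR_gt0 _.
have e : 0 < eta <= 1 / 4 by rewrite eta0.
have q01 : 0 <= q <= 1 by rewrite /q; apply/andP; split; move: eta0 eta4; lra.
have kq m : (m <= n)%N -> kappa <= q ^+ m.
  move=> mn; apply: le_trans (pow_ge_kappa e ne mn) _.
  by rewrite lerXn2r ?nnegrE /q //; move: eta0 eta4; lra.
have dec r s : (r <= s)%N -> (s <= n)%N -> kappa * eta * (s%:R - r%:R) <= q ^+ r - q ^+ s.
  move=> rs; elim: s rs => [|s IH]; first by rewrite leqn0 => /eqP -> _; rewrite !subrr mulr0.
  rewrite leq_eqVlt => /orP[/eqP -> _|]; first by rewrite !subrr mulr0.
  rewrite ltnS => rs sn; have := IH rs (ltnW sn).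
  have := ler_wpM2r (ltW eta0) (kq s (ltnW sn)).
  by rewrite exprS -natr1 /q; lra.
have sq r s : (r <= n)%N -> (s <= n)%N ->
    (kappa * eta) ^+ 2 * (r%:R - s%:R) ^+ 2 <= (q ^+ r - q ^+ s) ^+ 2.
  have main a b : (a <= b)%N -> (b <= n)%N ->
      (kappa * eta) ^+ 2 * (b%:R - a%:R) ^+ 2 <= (q ^+ a - q ^+ b) ^+ 2.
    move=> ab bn; rewrite -exprMn lerXn2r ?nnegrE ?dec //.
      by rewrite mulr_ge0 ?subr_ge0 ?ler_nat // mulr_ge0 // ltW.
    by rewrite subr_ge0 ler_wiXn2l //; case/andP: q01.
  move=> rn sn; have [rs|/ltnW sr] := leqP r s.
    by rewrite -(sqrrN (r%:R - _)) opprB main.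
  by rewrite -(sqrrN (q ^+ r - _)) opprB main.
have : \sum_(i < n) \sum_(j < n) (kappa * eta) ^+ 2 * (i%:R - j%:R) ^+ 2 <=
       \sum_(i < n) \sum_(j < n) (q ^+ i - q ^+ j) ^+ 2.
  by apply: ler_sum => i _; apply: ler_sum => j _; apply: sq; exact: ltnW.
rewrite (sum_sqr_diff (fun i : 'I_n => q ^+ i)).
under eq_bigr do rewrite -mulr_sumr.
rewrite -mulr_sumr (sum_sqr_diff (fun i : 'I_n => i%:R)) sum_ord_natr sum_ord_sqrr.
have -> : (kappa * eta) ^+ 2 * (2 * (n%:R * (n%:R * (n%:R - 1) * (2 * n%:R - 1) / 6) -
     (n%:R * (n%:R - 1) / 2) ^+ 2)) = 2 * (kappa ^+ 2 * eta ^+ 2 * (n%:R ^+ 2 * (n%:R ^+ 2 - 1) / 12)).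
  by field.
by lra.
Qed.

(** With [u = q ^+ n <= 1/5], the closed forms of the geometric sums leave at least
    [2 * (1 - u ^+ 2) - (1 - u) ^+ 2]. *)
Lemma sum_pow_diff_large : 4 <= n%:R * eta ->
  4 / 5 <= eta ^+ 2 * (n%:R * \sum_(i < n) (q ^+ i) ^+ 2 - (\sum_(i < n) q ^+ i) ^+ 2).
Proof.
move=> ne.
have q0 : 0 <= q by rewrite /q; move: eta4; lra.
have S1 : eta * \sum_(i < n) q ^+ i = 1 - q ^+ n.
  by have := subrX1 q n; rewrite /q => E; apply: oppr_inj; rewrite opprB E; ring.
have S2 : eta * (2 - eta) * \sum_(i < n) (q ^+ i) ^+ 2 = 1 - (q ^+ n) ^+ 2.
  have := subrX1 (q ^+ 2) n; rewrite -exprM mulnC exprM.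
  rewrite (eq_bigr (fun i : 'I_n => (q ^+ i) ^+ 2)) => [|i _]; last by rewrite -!exprM mulnC.
  by move=> E; apply: oppr_inj; rewrite opprB E /q; ring.
set X := \sum_(i < n) q ^+ i in S1 *; set Y := \sum_(i < n) _ in S2 *.
have Y0 : 0 <= Y by apply: sumr_ge0 => i _; exact: sqr_ge0.
set u := q ^+ n in S1 S2 *.
have u0 : 0 <= u by rewrite exprn_ge0.
have u5 : u <= 1 / 5.
  apply: (@le_trans _ _ (expR (- eta) ^+ n)).
    by rewrite lerXn2r ?nnegrE ?expR_ge0 // /q; exact: expR_ge1Dx.
  rewrite -expRM_natr mulNr expRN -[leRHS]invrK lef_pV2 ?posrE ?expR_gt0 ?invr_gt0 //.
  have := expR_ge1Dx (eta * n%:R); rewrite invf_div divr1 => h.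
  by rewrite (le_trans _ h) // mulrC; lra.
have Y2 : 1 - u ^+ 2 <= 2 * (eta * Y).
  by rewrite -S2; have := mulr_ge0 (sqr_ge0 eta) Y0; lra.
have eY0 : 0 <= eta * Y by rewrite mulr_ge0 // ltW.
have -> : eta ^+ 2 * (n%:R * Y - X ^+ 2) = (n%:R * eta) * (eta * Y) - (eta * X) ^+ 2 by ring.
rewrite S1; have := ler_wpM2r eY0 ne.
by nra.
Qed.

Lemma later1 s i : later eta (fun=> 1) s i = q ^+ (rev_ord i : 'I_n).
Proof.
have prodq m : (m <= n)%N -> \prod_(l < n | (l < m)%N) q = q ^+ m.
  elim: m => [|m IH] mn; first by rewrite big_pred0.
  rewrite exprS -(IH (ltnW mn)) (bigD1 (Ordinal mn)) //=; congr (_ * _).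
  by apply: eq_bigl => l; rewrite ltnS [in RHS]ltn_neqAle andbC.
rewrite /later mulr1 -/q (reindex_inj rev_ord_inj) /= -prodq ?leq_subr //.
by apply: eq_bigl => l; rewrite !ltn_subRL !addSn addnC.
Qed.

End Variance.

(** * The hard instance *)

Section HardInstance.
Variables (R : realType) (n : nat).
Hypothesis n2 : (2 <= n)%N.

Let p := n./2.

Definition lower_half : {set 'I_n} := [set i : 'I_n | (i < n./2)%N]%SET.
Definition upper_half : {set 'I_n} := [set i : 'I_n | (n./2 <= i < (n./2).*2)%N]%SET.

(* For odd n one component is left over; it gets curvature 1 and no shift. *)
Definition shift (i : 'I_n) : R := (i \in lower_half)%:R - (i \in upper_half)%:R.
Definition curv (i : 'I_n) : R := 1 + shift i.

(** With curvature 8, coordinate 0 stops contracting at [eta = 1/4]; below that, the factors of the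
    other coordinates stay between [1/2] and 1. *)
Definition hess_diag (i : 'I_n) : 'rV[R]_3 :=
  \row_j nth 0 [:: 8; curv i; 1] j.
Definition lin_part (i : 'I_n) : 'rV[R]_3 :=
  \row_j nth 0 [:: 0; shift i; shift i] j.

Definition hard (i : 'I_n) : 'rV[R]_3 -> R :=
  quad (diag_mx (hess_diag i)) (lin_part i) 0.

Definition o0 : 'I_3 := @Ordinal 3 0 isT.
Definition o1 : 'I_3 := @Ordinal 3 1 isT.
Definition o2 : 'I_3 := @Ordinal 3 2 isT.

Lemma sum_I3 (F : 'I_3 -> R) : \sum_i F i = F o0 + F o1 + F o2.
Proof.
rewrite !big_ord_recl big_ord0 addr0 addrA.
by congr (F _ + F _ + F _); apply: val_inj.
Qed.

Lemma half_gt0 : (0 < p)%N.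
Proof. by rewrite /p half_gt0. Qed.

Lemma double_half_le : (p.*2 <= n)%N.
Proof. by rewrite /p -[leqRHS]odd_double_half leq_addl. Qed.

Lemma half_ge : n%:R <= 3 * p%:R :> R.
Proof.
rewrite -natrM ler_nat -{1}[n]odd_double_half -/p -muln2 mulnC.
by have := half_gt0; case: (odd n) => //=; lia.
Qed.

Lemma card_ord_range a b : (a <= b)%N -> (b <= n)%N ->
  #|[set i : 'I_n | (a <= i < b)%N]%SET| = (b - a)%N.
Proof.
move=> ab bn; apply/eqP; rewrite -(eqr_nat R) -sum1_card natr_sum natrB //.
rewrite (eq_bigl (fun i : 'I_n => (i < b)%N && ~~ (i < a)%N)); last first.
  by move=> i; rewrite inE andbC [(a <= i)%N]leqNgt.
rewrite eq_sym subr_eq -(sum_ord_lt R bn) (bigID (fun i : 'I_n => (i < a)%N)) /= addrC.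
rewrite -(sum_ord_lt R (leq_trans ab bn)); apply/eqP; congr (_ + _).
by apply: eq_bigl => i; rewrite andb_idl // => /leq_trans; exact.
Qed.

Lemma card_lower : #|lower_half| = p.
Proof. by rewrite -[RHS]subn0 -card_ord_range // (leq_trans _ double_half_le) // -addnn leq_addr. Qed.

Lemma card_upper : #|upper_half| = p.
Proof. by rewrite /upper_half card_ord_range ?double_half_le // -addnn ?leq_addr // addnK. Qed.

Lemma lower_notin_upper e : e \in lower_half -> e \notin upper_half.
Proof. by rewrite !inE => lt; rewrite leqNgt lt. Qed.

Lemma shift_cases i : [\/ shift i = 1 /\ i \in lower_half,
  shift i = -1 /\ i \in upper_half | shift i = 0].
Proof.
rewrite /shift; have := @lower_notin_upper i.
case: (i \in lower_half) => [/(_ isT)/negbTE -> |_].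
  by constructor 1; rewrite subr0.
case: (i \in upper_half); first by constructor 2; rewrite sub0r.
by constructor 3; rewrite subrr.
Qed.

Lemma sum_shift : \sum_i shift i = 0.
Proof.
rewrite /shift sumrB -!natr_sum -!big_mkcond !sum1_card.
by rewrite card_lower card_upper subrr.
Qed.

Lemma sum_sqr_shift : \sum_i shift i ^+ 2 = 2 * p%:R.
Proof.
have sq i : shift i ^+ 2 = (i \in lower_half)%:R + (i \in upper_half)%:R.
  rewrite /shift; have := @lower_notin_upper i.
  case: (i \in lower_half) => [/(_ isT)/negbTE -> |_]; first by rewrite subr0 addr0 expr1n.
  by rewrite sub0r sqrrN add0r; case: (_ \in _); rewrite ?expr1n ?expr0n.
under eq_bigr do rewrite sq.
rewrite big_split /= -!natr_sum -!big_mkcond !sum1_card card_lower card_upper; ring.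
Qed.

Lemma curv_bounds i : 0 <= curv i <= 2.
Proof. by rewrite /curv; have [[-> _]|[-> _]|->] := shift_cases i; apply/andP; split; lra. Qed.

Lemma sum_curv : \sum_i curv i = n%:R.
Proof. by rewrite big_split /= sum_shift addr0 sumr_const card_ord. Qed.

Lemma grad_hard i x j :
  grad (hard i) x ord0 j = hess_diag i ord0 j * x ord0 j + lin_part i ord0 j.
Proof.
rewrite grad_quad /sympart tr_diag_mx -scalemxAr mulmxDr.
by rewrite mul_mx_diag mxE [X in X + _]mxE [X in _ * X]mxE [X in _ * (X + _)]mxE [X in _ * (_ + X)]mxE; field.
Qed.

Lemma dotv_diag (D : 'rV[R]_3) (x : 'rV[R]_3) :
  dotv (x *m diag_mx D) x = \sum_j D ord0 j * x ord0 j ^+ 2.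
Proof.
by rewrite mul_mx_diag; apply: eq_bigr => j _; rewrite mxE; ring.
Qed.

Lemma average_hard x : average hard x =
  4 * x ord0 o0 ^+ 2 + 2^-1 * x ord0 o1 ^+ 2 + 2^-1 * x ord0 o2 ^+ 2.
Proof.
have hE i : hard i x = 4 * x ord0 o0 ^+ 2 + (2^-1 * x ord0 o1 ^+ 2) * curv i +
    2^-1 * x ord0 o2 ^+ 2 + (x ord0 o1 + x ord0 o2) * shift i.
  by rewrite /hard quadE dotv_diag /dotv !sum_I3 !mxE /=; field.
rewrite /average; under eq_bigr do rewrite hE.
rewrite !big_split /= !sumr_const -!mulr_sumr sum_shift sum_curv card_ord.
rewrite -[4 * _ *+ n]mulr_natl -[2^-1 * _ *+ n]mulr_natl.
by field; rewrite pnatr_eq0; case: (n) n2.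
Qed.

Lemma hard_quadratic i : is_quadratic (hard i).
Proof. by exists (diag_mx (hess_diag i)), (lin_part i), 0. Qed.

Lemma sqr_l2norm3 (x : 'rV[R]_3) :
  l2norm x ^+ 2 = x ord0 o0 ^+ 2 + x ord0 o1 ^+ 2 + x ord0 o2 ^+ 2.
Proof. by rewrite sqr_l2norm /dotv sum_I3 !expr2. Qed.

Lemma hard_lipschitz i : lipschitz_grad 8 (hard i).
Proof.
split=> [x|x y]; first exact: differentiable_quad.
rewrite -(@ler_pXn2r _ 2) ?nnegrE ?mulr_ge0 ?l2norm_ge0 // exprMn.
have coord j : (grad (hard i) x - grad (hard i) y) ord0 j =
    hess_diag i ord0 j * (x - y) ord0 j.
  rewrite [LHS](_ : _ = grad (hard i) x ord0 j - grad (hard i) y ord0 j).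
    by rewrite !grad_hard [(x - y) _ _]mxE [(- y) _ _]mxE; ring.
  by move: (grad _ x) (grad _ y) => u v; rewrite !mxE.
rewrite !sqr_l2norm3 !coord; move: (x - y) => z.
rewrite !mxE /=; have /andP[c0 c2] := curv_bounds i.
have : (curv i * z ord0 o1) ^+ 2 <= 2 ^+ 2 * z ord0 o1 ^+ 2.
  by rewrite exprMn ler_wpM2r ?sqr_ge0 // lerXn2r ?nnegrE.
have := sqr_ge0 (z ord0 o1); have := sqr_ge0 (z ord0 o2).
by lra.
Qed.

Lemma hard_strongly_convex : strongly_convex 1 (average hard).
Proof.
move=> x y t /andP[t0 t1]; rewrite !average_hard sqr_l2norm3 !mxE.
set a0 := x _ o0; set a1 := x _ o1; set a2 := x _ o2.
set b0 := y _ o0; set b1 := y _ o1; set b2 := y _ o2.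
have h : 0 <= t * (1 - t) * (a0 - b0) ^+ 2 by rewrite mulr_ge0 ?sqr_ge0 // mulr_ge0 // subr_ge0.
by lra.
Qed.

Lemma hard_problem_class (rho nu : R) : admissible_params 8 1 rho nu ->
  problem_class 8 1 rho nu hard 0.
Proof.
move=> adm.
have [xs cls] := quadratic_problem_class adm hard_quadratic hard_lipschitz hard_strongly_convex.
suff -> : 0 = xs by [].
have [_ _ [_ uniq_min] _] := cls; apply: uniq_min => x.
rewrite !average_hard !mxE.
have := sqr_ge0 (x ord0 o0); have := sqr_ge0 (x ord0 o1); have := sqr_ge0 (x ord0 o2).
by lra.
Qed.

(** Coordinates 1 and 2 start at the minimizer and later show only bias and noise. *)
Definition start : 'rV[R]_3 := delta_mx ord0 o0.

Lemma l2norm_start : l2norm start = 1.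
Proof.
by rewrite /l2norm sum_I3 !mxE /= expr1n expr0n !addr0 sqrtr1.
Qed.

Lemma Gstar_hard : Gstar hard 0 = Num.sqrt 2.
Proof.
have g0 i : l2norm (grad (hard i) 0) = Num.sqrt (2 * shift i ^+ 2).
  rewrite /l2norm sum_I3 !grad_hard !mxE /=; congr Num.sqrt; ring.
apply/eqP; rewrite eq_le; apply/andP; split.
  rewrite /Gstar; apply: bigmax_le; first exact: sqrtr_ge0.
  move=> i _; rewrite g0 ler_sqrt //.
  by have [[-> _]|[-> _]|->] := shift_cases i; lra.
have [i iP] : exists i, i \in lower_half.
  by apply/set0Pn; rewrite -card_gt0 card_lower half_gt0.
apply: le_trans (le_bigmax _ (fun i => l2norm (grad (hard i) 0)) i).
rewrite g0; have [[-> _]|[_ iU]|s0] := shift_cases i; first by rewrite expr1n mulr1.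
  by have := lower_notin_upper iP; rewrite iU.
by move: s0; rewrite /shift iP (negbTE (lower_notin_upper iP)) subr0 => /eqP; rewrite oner_eq0.
Qed.

End HardInstance.

(** * The lower bound *)

Section LowerBound.
Variables (R : realType) (n K : nat) (eta : R).
Hypotheses (n2 : (2 <= n)%N) (K1 : (1 <= K)%N) (eta0 : 0 < eta).

Let kappa : R := expR (- 16).
Let N : R := n%:R.
Let M : R := K%:R.

Definition msq (j : 'I_3) : R := rr_expect (fun s : {ffun 'I_K -> 'S_n} =>
  rr_iterate (@hard R n) eta (start R) s ord0 j ^+ 2).

Lemma rr_gap_hard : rr_gap K (@hard R n) eta 0 (start R) =
  4 * msq o0 + 2^-1 * msq o1 + 2^-1 * msq o2.
Proof.
have gapE x : average (@hard R n) x - average (@hard R n) 0 =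
    4 * x ord0 o0 ^+ 2 + (2^-1 * x ord0 o1 ^+ 2 + 2^-1 * x ord0 o2 ^+ 2).
  by rewrite !average_hard // !mxE; ring.
rewrite /rr_gap -[rr_expect _]/(avg _); under eq_avg do rewrite gapE.
by rewrite !avgD !avgZ addrA.
Qed.

Lemma grad_hard0 i x : grad (@hard R n i) x ord0 o0 = 8 * x ord0 o0 + 0.
Proof. by rewrite grad_hard /hess_diag /lin_part !mxE. Qed.

Lemma grad_hard1 i x :
  grad (@hard R n i) x ord0 o1 = curv R i * x ord0 o1 + shift R i.
Proof. by rewrite grad_hard [hess_diag _ _ _ _]mxE [lin_part _ _ _ _]mxE. Qed.

Lemma grad_hard2 i x :
  grad (@hard R n i) x ord0 o2 = 1 * x ord0 o2 + shift R i.
Proof. by rewrite grad_hard [hess_diag _ _ _ _]mxE [lin_part _ _ _ _]mxE. Qed.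

Lemma start_coord j : start R ord0 j = (j == o0)%:R.
Proof. by rewrite mxE eqxx. Qed.

Lemma msq_ge0 j : 0 <= msq j.
Proof. by apply: avg_ge0 => s; exact: sqr_ge0. Qed.

Lemma msq0 : msq o0 = ((1 - 8 * eta) ^+ 2) ^+ (n * K).
Proof.
have noise0 s : noise eta (fun _ : 'I_n => 8) (fun=> 0) s = 0.
  by rewrite /noise big1 // => i _; rewrite mul0r.
have an0 : avg (noise eta (fun _ : 'I_n => 8) (fun=> 0)) = 0.
  by rewrite (eq_avg noise0) avg_cst ?card_Sn_gt0.
rewrite /msq (rr_expect_sqr_coord grad_hard0 K (start R) an0).
rewrite [avg (fun s => _ ^+ 2)](_ : _ = 0); last first.
  rewrite (@eq_avg _ _ _ (fun=> 0)) ?avg_cst ?card_Sn_gt0 // => s.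
  by rewrite noise0 expr0n.
rewrite mulr0 mul0r addr0 start_coord eqxx expr1n mulr1 /decay prodr_const card_ord.
by rewrite [eta * 8]mulrC -!exprM; congr (_ ^+ _); lia.
Qed.

Lemma msq0_large : 1 / 4 <= eta -> 1 <= msq o0.
Proof.
move=> e4; rewrite msq0 exprn_ege1 //.
have : 0 <= (4 * eta - 1) * eta by rewrite mulr_ge0 ?(ltW eta0) //; lra.
by lra.
Qed.

(** Bernoulli's inequality for [2 n K] equal factors: the loss is at most [16 n K eta]. *)
Lemma msq0_small : 32 * N * M * eta <= 1 -> 1 / 2 <= msq o0.
Proof.
move=> small; rewrite msq0 -exprM.
have NM : 1 <= N * M by rewrite /N /M -natrM ler1n muln_gt0 K1 (ltnW n2).
have e8 : 0 <= 8 * eta <= 1.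
  apply/andP; split; first by rewrite mulr_ge0 // ltW.
  by have := ler_wpM2r (ltW eta0) NM; lra.
have := @prod_1B_bounds R (2 * (n * K)) (fun=> 8 * eta) (fun=> e8).
rewrite prodr_const sumr_const card_ord => -[/andP[+ _] _].
apply: le_trans; rewrite -[8 * eta *+ _]mulr_natl !natrM -/N -/M; lra.
Qed.

Section SmallSteps.
Hypotheses (eta4 : eta <= 1 / 4) (not_tiny : 1 <= 32 * N * M * eta).

Let e : 0 < eta <= 1 / 4. Proof. by rewrite eta0. Qed.
Let N_gt0 : 0 < N. Proof. by rewrite /N ltr0n ltnW. Qed.

Lemma decay_bounds (h : 'I_n -> R) : (forall i, 0 <= h i <= 2) -> \sum_i h i = N ->
  [/\ 0 <= decay eta h, decay eta h <= 1, 1 - decay eta h <= N * eta &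
      decay eta h <= expR (- (N * eta))].
Proof.
move=> h02 hN.
have x01 i : 0 <= eta * h i <= 1.
  have /andP[h0 h2] := h02 i; have /andP[e0 e1] := e.
  by apply/andP; split; nra.
have := prod_1B_bounds x01; rewrite -mulr_sumr hN -/(decay eta h) [eta * N]mulrC.
by move=> [/andP[lo hi] [/andP[p0 p1] _]]; split=> //; lra.
Qed.

Lemma sqr_mean_le j : rr_expect (fun s : {ffun 'I_K -> 'S_n} =>
  rr_iterate (@hard R n) eta (start R) s ord0 j) ^+ 2 <= msq j.
Proof.
rewrite /msq /rr_expect -!/(avg _); apply: sqr_avg_le.
by rewrite card_ffun card_ord expn_gt0 card_Sn_gt0.
Qed.

(** The squared mean is used. An epoch has bias at least [n./2 * eta * kappa] and the geometric sum
    is at least [1 / (33 * N * eta)], so the mean has size at least [eta * kappa / 99]; [not_tiny]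
    bounds [eta] below. *)
Lemma msq1_ge : N * eta <= 4 -> (kappa / (99 * 32 * N * M)) ^+ 2 <= msq o1.
Proof.
move=> ne; apply: le_trans (sqr_mean_le o1).
rewrite (rr_expect_coord eta grad_hard1) start_coord mulr0 sub0r sqrrN.
have [P0 P1 Pz Pe] := decay_bounds (@curv_bounds R n) (sum_curv R n).
set bias := avg _; set S := \sum_(k < K) _.
have k0 : 0 < kappa := expR_gt0 _.
have M_gt0 : 0 < M by rewrite /M ltr0n.
have nuge : (n./2)%:R * (eta * kappa) <= bias.
  apply: (@avg_noise_ge R n eta kappa (@curv R n) eta0 _ (@shift R n) (lower_half n) (upper_half n)).
  - by move=> s i; apply: later_ge => //; exact: curv_bounds.
  - exact: half_gt0.
  - exact: card_lower R n.
  - exact: card_upper R n.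
  - exact: lower_notin_upper.
  - by [].
  - by move=> i il; rewrite /curv /shift il (negbTE (lower_notin_upper il)) subr0 -(natrD R 1 1).
  - move=> i iu; rewrite /curv /shift iu.
    have /negbTE -> : i \notin lower_half n.
      by apply: contraTN iu; exact: lower_notin_upper.
    by rewrite sub0r subrr.
have Sge : 1 <= 33 * (N * eta) * S.
  apply: sum_geom_ge => //; first by rewrite mulr_gt0.
  by move: not_tiny; rewrite -/M; lra.
have S0 : 0 <= S by apply: sumr_ge0 => k _; rewrite exprn_ge0.
have half3 : N <= 3 * (n./2)%:R by exact: half_ge.
set p := (n./2)%:R in nuge half3.
have ek : 0 < eta * kappa by rewrite mulr_gt0.
have main : eta * kappa / 99 <= eta * bias * S.
  have h1 : eta * (p * (eta * kappa)) * S <= eta * bias * S.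
    by rewrite ler_wpM2r // ler_wpM2l // ltW.
  apply: le_trans h1.
  have h2 : eta * kappa * (N * eta * S) <= eta * kappa * (3 * p * eta * S).
    by rewrite ler_wpM2l ?(ltW ek) // ler_wpM2r // ler_wpM2r // ltW.
  have h3 : eta * kappa * 1 <= eta * kappa * (33 * (N * eta) * S).
    by rewrite ler_wpM2l ?(ltW ek).
  by lra.
have den : 0 < 99 * 32 * N * M by rewrite !mulr_gt0.
rewrite lerXn2r ?nnegrE ?divr_ge0 ?(ltW den) ?(ltW k0) //.
  by apply: le_trans main; rewrite divr_ge0 // ltW.
apply: le_trans main; rewrite ler_pdivrMr //.
have := ler_wpM2l (ltW k0) not_tiny; lra.
Qed.

(** With constant curvature the damping is deterministic, so [avg_sqr_perm_sum] is exact; reversing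
    the weights leaves their sums unchanged. *)
Lemma variance_term : msq o2 = eta ^+ 2 *
  (2 * (n./2)%:R / (N * (N - 1)) *
     (N * \sum_(i < n) ((1 - eta) ^+ i) ^+ 2 - (\sum_(i < n) (1 - eta) ^+ i) ^+ 2)) *
  \sum_(k < K) ((1 - eta) ^+ n ^+ 2) ^+ k.
Proof.
have noiseE s : noise eta (fun _ : 'I_n => 1) (@shift R n) s =
    \sum_i (1 - eta) ^+ (rev_ord i : 'I_n) * shift R (s i).
  by apply: eq_bigr => i _; rewrite later1 mulrC.
have an0 : avg (noise eta (fun _ : 'I_n => 1) (@shift R n)) = 0.
  rewrite (eq_avg noiseE) avg_sum big1 // => i _.
  by rewrite avgZ (avg_perm1 (@shift R n)) (sum_shift R n) !mulr0.
rewrite /msq (rr_expect_sqr_coord grad_hard2 K (start R) an0).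
rewrite start_coord expr0n mulr0 add0r; congr (_ * _ * _).
  rewrite (@eq_avg _ _ _ (fun s : 'S_n => (\sum_i (1 - eta) ^+ (rev_ord i : 'I_n) * shift R (s i)) ^+ 2)).
    rewrite avg_sqr_perm_sum ?(sum_shift R n) // (sum_sqr_shift R n).
    by congr (_ * (_ * _ - _ ^+ 2)); rewrite [RHS](reindex_inj rev_ord_inj).
  by move=> s; rewrite noiseE.
by apply: eq_bigr => k _; rewrite /decay prodr_const card_ord mulr1.
Qed.

(** An epoch adds variance of order [eta^4 N^3], accumulated over about [1 / (N eta)] epochs; then
    [eta >= 1 / (32 N M)]. The product [33 * 36] is [18 * 66]. *)
Lemma msq2_ge_small : N * eta <= 4 -> kappa ^+ 2 / (33 * 36 * 32 ^+ 3 * N * M ^+ 3) <= msq o2.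
Proof.
move=> ne; have one_sum : \sum_(i < n) (1 : R) = N by rewrite sumr_const card_ord.
have h1 (i : 'I_n) : 0 <= (1 : R) <= 2 by apply/andP; split; lra.
pose P : R := (1 - eta) ^+ n.
have [P0 P1 Pz Pe] : [/\ 0 <= P, P <= 1, 1 - P <= N * eta & P <= expR (- (N * eta))].
  have := decay_bounds h1 one_sum; rewrite /decay prodr_const card_ord mulr1.
  by [].
clear h1; rewrite variance_term -/P.
have M_gt0 : 0 < M by rewrite /M ltr0n.
have P2 : 1 - P ^+ 2 <= 2 * (N * eta).
  have : P * (1 - P) <= 1 * (1 - P) by rewrite ler_wpM2r // subr_ge0.
  by move: Pz; lra.
have Sge : 1 <= 33 * (2 * (N * eta)) * \sum_(k < K) (P ^+ 2) ^+ k.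
  have Ne0 : 0 < N * eta by rewrite mulr_gt0.
  apply: sum_geom_ge; first exact: sqr_ge0.
  - exact: P2.
  - have -> : - (2 * (N * eta)) = - (N * eta) + - (N * eta) by ring.
    by rewrite expRD expr2 ler_pM.
  - by rewrite mulr_gt0.
  - by move: not_tiny; rewrite -/M; lra.
set S := \sum_(k < K) _ in Sge *.
have S0 : 0 <= S by apply: sumr_ge0 => k _; rewrite exprn_ge0 ?sqr_ge0.
have vs := sum_pow_diff_small eta0 eta4 ne.
rewrite -/N -/kappa in vs; set V := (X in _ <= X) in vs.
rewrite -/V.
have N1 : 0 < N - 1 by rewrite subr_gt0 /N ltr1n.
have half3 : N <= 3 * (n./2)%:R by exact: half_ge.
set p := (n./2)%:R in half3 *.
have k0 : 0 < kappa := expR_gt0 _.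
have V1 : kappa ^+ 2 * eta ^+ 2 * N ^+ 3 / 18 <= 2 * p / (N * (N - 1)) * V.
  have c0 : 0 <= 2 * p / (N * (N - 1)).
    by apply: divr_ge0; [rewrite mulr_ge0 | rewrite mulr_ge0 // ltW].
  apply: le_trans (ler_wpM2l c0 vs).
  have -> : 2 * p / (N * (N - 1)) * (kappa ^+ 2 * eta ^+ 2 * (N ^+ 2 * (N ^+ 2 - 1) / 12)) =
      kappa ^+ 2 * eta ^+ 2 * (p * N * (N + 1)) / 6.
    by field; rewrite !gt_eqF.
  have h2 : 0 <= kappa ^+ 2 * eta ^+ 2 by rewrite mulr_ge0 ?sqr_ge0.
  have h3 : N ^+ 3 <= 3 * (p * N * (N + 1)).
    have := ler_wpM2r (mulr_ge0 (ltW N_gt0) (ltW N_gt0)) half3.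
    have : 0 <= p * N by rewrite mulr_ge0 // ltW.
    by lra.
  by have := ler_wpM2l h2 h3; lra.
have e2 : 0 <= eta ^+ 2 by exact: sqr_ge0.
have step1 : eta ^+ 2 * (kappa ^+ 2 * eta ^+ 2 * N ^+ 3 / 18) * S <=
    eta ^+ 2 * (2 * p / (N * (N - 1)) * V) * S.
  by rewrite ler_wpM2r // ler_wpM2l.
apply: le_trans step1.
have c1 : 0 <= kappa ^+ 2 * eta ^+ 3 * N ^+ 2.
  apply: mulr_ge0; last exact: sqr_ge0.
  by apply: mulr_ge0; [exact: sqr_ge0 | rewrite exprn_ge0 // ltW].
apply: (@le_trans _ _ (kappa ^+ 2 * eta ^+ 3 * N ^+ 2 / (33 * 36))); last first.
  by have := ler_wpM2l c1 Sge; lra.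
have den0 : 0 < 33 * 36 * 32 ^+ 3 :> R by lra.
have den : 0 < 33 * 36 * 32 ^+ 3 * N * M ^+ 3.
  by apply: mulr_gt0; [apply: mulr_gt0 | rewrite exprn_gt0].
rewrite ler_pdivrMr //.
have -> : kappa ^+ 2 * eta ^+ 3 * N ^+ 2 / (33 * 36) * (33 * 36 * 32 ^+ 3 * N * M ^+ 3) =
    kappa ^+ 2 * (32 * N * M * eta) ^+ 3 by field.
by rewrite ler_peMr ?sqr_ge0 // exprn_ege1.
Qed.

(** Only the noise of the last epoch, the term [k = 0], is kept. *)
Lemma msq2_ge_large : 4 <= N * eta -> 8 / (15 * N) <= msq o2.
Proof.
move=> ne; rewrite variance_term.
have vl := sum_pow_diff_large eta0 eta4 ne.
rewrite -/N in vl; set V := (X in _ <= _ * X) in vl.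
rewrite -/V.
have N1 : 0 < N - 1 by rewrite subr_gt0 /N ltr1n.
have half3 : N <= 3 * (n./2)%:R by exact: half_ge.
set p := (n./2)%:R in half3 *.
have c0 : 0 <= 2 * p / (N * (N - 1)).
  by apply: divr_ge0; [rewrite mulr_ge0 | rewrite mulr_ge0 // ltW].
have S1 : 1 <= \sum_(k < K) ((1 - eta) ^+ n ^+ 2) ^+ k.
  have -> : K = K.-1.+1 by rewrite prednK.
  rewrite big_ord_recl expr0 lerDl; apply: sumr_ge0 => k _.
  by rewrite exprn_ge0 ?sqr_ge0.
have r0 : 0 <= 8 / (15 * N).
  by apply: divr_ge0 => //; apply: mulr_ge0 => //; exact: ltW.
have step : 8 / (15 * N) <= eta ^+ 2 * (2 * p / (N * (N - 1)) * V).
  rewrite mulrCA; apply: le_trans (ler_wpM2l c0 vl).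
  have -> : 2 * p / (N * (N - 1)) * (4 / 5) = 8 / (15 * N) * (3 * p / (N - 1)).
    by field; rewrite !gt_eqF.
  rewrite ler_peMr ?r0 // ler_pdivlMr // mul1r; move: half3; lra.
by apply: (le_trans step); rewrite ler_peMr // (le_trans r0).
Qed.

End SmallSteps.

(** Outside the middle regime the gap is at least of order [1 / N], which dominates both [A] and
    [B]. The middle regime fixes the constant: [2^27] exceeds [2 * 33 * 36 * 32^3]. *)
Lemma rr_gap_hard_ge :
  kappa ^+ 2 / 2 ^+ 27 * (((n * K)%:R ^+ 2)^-1 + (n%:R * K%:R ^+ 3)^-1) <=
  rr_gap K (@hard R n) eta 0 (start R).
Proof.
rewrite rr_gap_hard natrM -/N -/M.
have N0 : 0 < N by rewrite /N ltr0n ltnW.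
have N1 : 1 <= N by rewrite /N ler1n ltnW.
have M1 : 1 <= M by rewrite /M ler1n.
have M0 : 0 < M by exact: lt_le_trans M1.
have k0 : 0 < kappa := expR_gt0 _.
have k1 : kappa ^+ 2 <= 1.
  by rewrite exprn_ile1 ?(ltW k0) // -[leRHS]expR0 ler_expR oppr_le0.
have M2 : 1 <= M ^+ 2 by exact: exprn_ege1.
have M3 : 1 <= M ^+ 3 by exact: exprn_ege1.
set A := ((N * M) ^+ 2)^-1; set B := (N * M ^+ 3)^-1.
have A0 : 0 <= A by rewrite invr_ge0 sqr_ge0.
have B0 : 0 <= B by rewrite invr_ge0 mulr_ge0 ?exprn_ge0 // ltW.
have AN : A <= N^-1.
  rewrite lef_pV2 ?posrE ?exprn_gt0 ?mulr_gt0 // exprMn expr2 -mulrA.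
  by rewrite ler_peMr ?(ltW N0) // mulr_ege1.
have BN : B <= N^-1.
  by rewrite lef_pV2 ?posrE ?mulr_gt0 ?exprn_gt0 // ler_peMr // ltW.
have N11 : N^-1 <= 1 by rewrite invf_le1.
have kA : kappa ^+ 2 * A <= A by rewrite ler_piMl.
have kB : kappa ^+ 2 * B <= B by rewrite ler_piMl.
have m0 := msq_ge0 o0; have m1 := msq_ge0 o1; have m2 := msq_ge0 o2.
have kA0 : 0 <= kappa ^+ 2 * A by rewrite mulr_ge0 ?sqr_ge0.
have kB0 : 0 <= kappa ^+ 2 * B by rewrite mulr_ge0 ?sqr_ge0.
have [e4|/ltW e4] := leP (1 / 4) eta.
  by have := msq0_large e4; lra.
have [small|/ltW big] := leP (32 * N * M * eta) 1.
  by have := msq0_small small; lra.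
have [ne|/ltW ne] := leP 4 (N * eta).
  have := msq2_ge_large e4 ne.
  have -> : 8 / (15 * N) = 8 / 15 * N^-1 by field; rewrite gt_eqF.
  by lra.
have := msq1_ge e4 big ne; have := msq2_ge_small e4 big ne.
have -> : (kappa / (99 * 32 * N * M)) ^+ 2 = kappa ^+ 2 * A / (99 * 32) ^+ 2.
  by rewrite /A; field; rewrite !gt_eqF.
have -> : kappa ^+ 2 / (33 * 36 * 32 ^+ 3 * N * M ^+ 3) = kappa ^+ 2 * B / (33 * 36 * 32 ^+ 3).
  by rewrite /B; field; rewrite !gt_eqF.
by lra.
Qed.

End LowerBound.

Theorem corollary5p5 (R : realType) :
  (* explicit bound *)
  (forall (L mu rho nu : R) (d n K : nat) (f : 'I_n -> 'rV[R]_d -> R)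
      (xs y0 : 'rV[R]_d),
    admissible_params L mu rho nu ->
    problem_class L mu rho nu f xs ->
    rr_regime L mu n K ->
    let T : R := (n * K)%:R in
    let D := Dconst L f xs y0 in
    let G := Gconst L f xs y0 in
    rr_sqdist K f (rr_stepsize mu n K) xs y0 <=
      D ^+ 2 / T ^+ 2
      + 1024 * L ^+ 2 * G ^+ 2 * ln T ^+ 2 / (mu ^+ 4 * T ^+ 2)
      + 384 * L ^+ 2 * G ^+ 2 * n%:R ^+ 2 * ln T ^+ 3 / (mu ^+ 4 * T ^+ 3)
      + 2 `^ (7 + 2 * nu) / (1 + nu) ^+ 2
        * (rho ^+ 2 * G `^ (2 + 2 * nu) * n%:R `^ (1 + nu)
             * ln T `^ (2 + 2 * nu)
           / (mu `^ (4 + 2 * nu) * T `^ (2 + 2 * nu)))) /\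
  (* function-value rate *)
  rr_gap_tildeO (fun _ : R => True)
    (fun nu n K => let T : R := (n * K)%:R in
       T ^- 2 + n%:R ^+ 2 * T ^- 3
       + n%:R `^ (1 + nu) * T `^ (- (2 + 2 * nu))) /\
  (* nu >= 1/2: comparison of the rates, and the resulting rate *)
  (forall (nu : R) (n K : nat), 2^-1 <= nu <= 1 -> (2 <= n)%N -> (1 <= K)%N ->
    let T : R := (n * K)%:R in
    n%:R `^ (1 + nu) * T `^ (- (2 + 2 * nu)) <= n%:R ^+ 2 * T ^- 3) /\
  rr_gap_tildeO (fun nu : R => 2^-1 <= nu)
    (fun _ n K => let T : R := (n * K)%:R in
       T ^- 2 + n%:R ^+ 2 * T ^- 3) /\
  (* the class contains the smooth strongly convex quadratic instances *)
  (forall (L mu rho nu : R) (d n : nat) (f : 'I_n -> 'rV[R]_d -> R),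
    admissible_params L mu rho nu -> (2 <= n)%N ->
    (forall i, is_quadratic (f i)) ->
    (forall i, lipschitz_grad L (f i)) ->
    strongly_convex mu (average f) ->
    exists xs : 'rV[R]_d, problem_class L mu rho nu f xs) /\
  (* quadratic lower bound, for every constant stepsize *)
  (exists (d : nat) (L mu G D c : R), [/\ 0 < mu <= L, 0 < c &
    forall n K : nat, (2 <= n)%N -> (1 <= K)%N ->
    exists (f : 'I_n -> 'rV[R]_d -> R) (xs y0 : 'rV[R]_d),
      [/\ forall i, is_quadratic (f i),
          forall rho nu : R, admissible_params L mu rho nu ->
            problem_class L mu rho nu f xs,
          Dconst L f xs y0 = D,
          Gconst L f xs y0 = G &
          forall eta : R, 0 < eta ->
            c * (((n * K)%:R ^+ 2)^-1 + (n%:R * K%:R ^+ 3)^-1)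
              <= rr_gap K f eta xs y0]]).
Proof.
split; first exact: rr_sqdist_bound.
split; first exact: rr_gap_rate.
split; first exact: holder_rate_le.
split; first exact: rr_gap_rate_half.
split; first by move=> L mu rho nu d n f adm _; exact: quadratic_problem_class.
(* [8] and [1] are the extreme curvatures of the average; [G] and [D] come from [Gstar = sqrt 2] and
   initial distance 1, for all [n] and [K]. *)
exists 3, 8, 1, (Num.sqrt 2 + 2 * 8 * Num.max 1 (Num.sqrt 2 / (2 * 8))),
  (Num.max 1 (Num.sqrt 2 / (2 * 8))), (expR (- 16) ^+ 2 / 2 ^+ 27).
split; [by apply/andP; split; lra | by rewrite divr_gt0 ?exprn_gt0 ?expR_gt0 |].
move=> n K n2 K1; exists (@hard R n), 0, (start R).
have DE : Dconst 8 (@hard R n) 0 (start R) = Num.max 1 (Num.sqrt 2 / (2 * 8)).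
  by rewrite /Dconst subr0 l2norm_start Gstar_hard.
split=> //; first exact: hard_quadratic.
- by move=> rho nu adm; exact: hard_problem_class.
- by rewrite /Gconst DE Gstar_hard.
- by move=> eta eta0; exact: rr_gap_hard_ge.
Qed.
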